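(* Let $K\subset\mathbb{C}$ be a compact set such that $\mathbb{C}\setminus K$ is connected. Then every $z_0\in\partial K$ is a peak point for $A(K)$. Hence $\mathcal{P}(A(K))=\partial K$.
   Context: $A(K)$ is the uniform algebra (with the sup norm on $K$) of all complex-valued functions continuous on $K$ and holomorphic on the interior $\mathrm{int}(K)$. $\partial K$ is the topological boundary of $K$ in $\mathbb{C}$. A point $z\in K$ is a peak point for $A(K)$ if there exists $f\in A(K)$ with $f(z)=1$ and $|f(w)|<1$ for all $w\in K\setminus\{z\}$. $\mathcal{P}(A(K))$ is the set of all peak points for $A(K)$. *)

(* Defs.v *)
From HB Require Import structures.
From mathcomp Require Import all_boot all_order all_algebra.
From mathcomp Require Import complex.
From mathcomp Require Import all_classical all_reals all_analysis.
Import Order.TTheory GRing.Theory Num.Theory numFieldNormedType.Exports.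

Set Implicit Arguments.
Unset Strict Implicit.
Unset Printing Implicit Defensive.

Local Open Scope classical_set_scope.
Local Open Scope ring_scope.
Local Open Scope complex_scope.

(* The complex plane is [R[i]^o]: the field [R[i]] with the norm topology of a
   normed module over itself.  The norm [`|z|] takes its values in [R[i]], where
   [`|z| < 1] holds exactly when the modulus of [z] is less than 1. *)

Definition boundary (T : topologicalType) (A : set T) : set T :=
  closure A `\` interior A.

(* The increment in [derivable] ranges over the scalar field, here [R[i]], so
   this is complex differentiability. *)
Definition holomorphic_on (R : realType) (U : set R[i]^o)
    (f : R[i]^o -> R[i]^o) : Prop :=
  forall z, U z -> derivable f z 1.

(* Elements of A(K) are represented by total functions, whose values off K are
   irrelevant. *)
Definition algebraA (R : realType) (K : set R[i]^o) : set (R[i]^o -> R[i]^o) :=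
  [set f | {within K, continuous f} /\ holomorphic_on (interior K) f].

Definition peak_point (R : realType) (K : set R[i]^o)
    (A : set (R[i]^o -> R[i]^o)) (z : R[i]^o) : Prop :=
  K z /\ exists f, [/\ A f, f z = 1 & forall w, (K `\ z) w -> `|f w| < 1].

Definition peak_points (R : realType) (K : set R[i]^o)
    (A : set (R[i]^o -> R[i]^o)) : set R[i]^o :=
  [set z | peak_point K A z].

(* Main.v *)
(** At a boundary point [z0] and a scale [r], connectedness of the complement of
    [K] yields [a] close to [z0] and [b] at distance about [r] from [z0], joined
    off [K] inside the disc of radius [r]; hence [g = sqrt ((z - a) / (z - b))]
    has a branch on [K] that is close to 1 far from [z0].  The function
    [1 - 4 (z - z0) / ((z - b) (1 + g)^2)] takes the value 1 at [z0], is bounded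
    on [K] independently of [r], and is [O(r / |z - z0|)] away from [z0].  A
    geometrically weighted series of such functions, for radii decreasing very
    fast, peaks at [z0] (Bishop's argument).

    Conversely, if [f] peaks at an interior point [z0], then [u = 1 - f] has
    positive real part off [z0], and [u] and its derivative vanish at [z0].  By
    Goursat's argument [1 / (t + u)] has zero integral around a square with [z0]
    in the middle of its bottom side.  As [t] tends to 0 the other three sides
    contribute [O(1)], while the real part of the bottom one tends to infinity:
    contradiction. *)

Require Import Defs.
From HB Require Import structures.
From mathcomp Require Import all_boot all_order all_algebra.
From mathcomp Require Import complex.
From mathcomp Require Import all_classical all_reals all_analysis.
From mathcomp Require Import ring lra.
Import Order.TTheory GRing.Theory Num.Theory numFieldNormedType.Exports.

Set Implicit Arguments.
Unset Strict Implicit.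
Unset Printing Implicit Defensive.

Local Open Scope classical_set_scope.
Local Open Scope ring_scope.
Local Open Scope complex_scope.

Local Notation N := (@Normc.normc _).
Local Notation re := (@complex.Re _).
Local Notation im := (@complex.Im _).

(** * The real-valued modulus, and limits and derivatives in epsilon-delta form *)

Section Modulus.
Variable R : realType.
Implicit Types (z w : R[i]) (x : R).

Lemma normr_normc z : `|z| = (N z)%:C.
Proof. by rewrite normc_def; case: z. Qed.

Lemma normc_ge0 z : 0 <= N z.
Proof. by rewrite -lecR -normr_normc; exact: normr_ge0. Qed.

Lemma normcD z w : N (z + w) <= N z + N w.
Proof. exact: le_normcD. Qed.

Lemma normcB z w : N (z - w) = N (w - z).
Proof. by rewrite -opprB normcN. Qed.

Lemma normcBD z w : N (z - w) <= N z + N w.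
Proof. by rewrite (le_trans (normcD _ _))// normcN. Qed.

Lemma normcR x : N x%:C = `|x|.
Proof. by rewrite /= expr0n addr0 sqrtr_sqr. Qed.

Lemma normc_nat n : N (n%:R : R[i]) = n%:R.
Proof. by rewrite -(rmorph_nat (real_complex R)) normcR normr_nat. Qed.

Lemma normc_eq0 z : (N z == 0) = (z == 0).
Proof.
by apply/eqP/eqP => [/Normc.eq0_normc//|->]; rewrite Normc.normc0.
Qed.

Lemma normc_gt0 z : (0 < N z) = (z != 0).
Proof. by rewrite lt_def normc_ge0 andbT normc_eq0. Qed.

Lemma normc_sqr z : N z ^+ 2 = re z ^+ 2 + im z ^+ 2.
Proof. by case: z => a b /=; rewrite sqr_sqrtr// addr_ge0// sqr_ge0. Qed.

Lemma normcX z n : N (z ^+ n) = N z ^+ n.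
Proof. by elim: n => [|n ih]; rewrite ?Normc.normc1// !exprS Normc.normcM ih. Qed.

Lemma ReD z w : re (z + w) = re z + re w. Proof. by case: z; case: w. Qed.
Lemma ReB z w : re (z - w) = re z - re w. Proof. by case: z; case: w. Qed.

Lemma ler_Re_normc z : `|re z| <= N z.
Proof. by rewrite -lecR -normr_normc normc_ge_Re. Qed.

Lemma ler_Im_normc z : `|im z| <= N z.
Proof.
rewrite -(ler_pXn2r (n := 2))// ?nnegrE ?normc_ge0// normc_sqr.
by rewrite real_normK ?num_real// lerDr sqr_ge0.
Qed.

Lemma normc_le_ReIm z : N z <= `|re z| + `|im z|.
Proof.
rewrite -(ler_pXn2r (n := 2))// ?nnegrE ?normc_ge0// ?addr_ge0//.
rewrite normc_sqr sqrrD !real_normK ?num_real//.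
by rewrite -addrAC -[leLHS]addr0 lerD// mulrn_wge0// mulr_ge0.
Qed.

Lemma ltr0_complex (e : R[i]) : 0 < e -> exists2 d : R, 0 < d & e = d%:C.
Proof.
case: e => a b; rewrite ltcE /= => /andP[/eqP -> a0].
by exists a.
Qed.

Lemma nbhs_normcP (z : R[i]^o) (A : set R[i]^o) :
  nbhs z A <-> exists2 e : R, 0 < e & forall w : R[i], N (w - z) < e -> A w.
Proof.
have HP := @nbhs_normP _ (R[i]^o : normedModType R[i]) z A; split.
  move/HP; case=> e /= /ltr0_complex[d d0 ->] H; exists d => // w wd.
  by apply: H; rewrite /= distrC normr_normc ltcR.
case=> e e0 H; apply/HP; exists e%:C => /=; first by rewrite ltcR.
by move=> w /=; rewrite distrC normr_normc ltcR => /H.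
Qed.

Lemma cvg_normcP {T} (F : set_system T) {FF : Filter F} (f : T -> R[i]^o) (l : R[i]^o) :
  f x @[x --> F] --> l <-> forall e : R, 0 < e -> \forall x \near F, N (f x - l) <= e.
Proof.
split.
  move/cvgrPdist_le => H e e0; have /H : 0 < e%:C by rewrite ltcR.
  by apply: filterS => x; rewrite distrC normr_normc lecR.
move=> H; apply/cvgrPdist_le => _ /ltr0_complex[d d0 ->].
by apply: filterS (H _ d0) => x; rewrite distrC normr_normc lecR.
Qed.

Lemma continuous_normcP (f : R[i]^o -> R[i]^o) (z : R[i]^o) :
  {for z, continuous f} <-> forall e : R, 0 < e ->
    exists2 d : R, 0 < d & forall w : R[i], N (w - z) < d -> N (f w - f z) <= e.
Proof.
have HP := @cvg_normcP _ (nbhs z) _ f (f z).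
split; first by move=> /HP H e /H /nbhs_normcP.
by move=> H; apply/HP => e /H /nbhs_normcP.
Qed.

Lemma derivable_normcP (f : R[i]^o -> R[i]^o) (z : R[i]^o) :
  derivable f z 1 <-> exists l : R[i], forall e : R, 0 < e ->
    exists2 d : R, 0 < d & forall w : R[i], N (w - z) < d ->
      N (f w - f z - l * (w - z)) <= e * N (w - z).
Proof.
have HP := @cvg_normcP _ (0^') _ (fun h : R[i]^o => h^-1 *: ((f \o shift z) (h *: 1) - f z)).
split.
  move/cvg_ex => [l /HP H]; exists l => e /H.
  rewrite near_withinE => /nbhs_normcP[d d0 Hd]; exists d => // w wd.
  have [->|wz] := eqVneq w z; first by rewrite !subrr mulr0 subrr Normc.normc0 mulr0.
  have := Hd (w - z); rewrite subr0 => /(_ wd); rewrite subr_eq0 => /(_ wz).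
  rewrite /= /GRing.scale /= mulr1 subrK => {}Hd.
  rewrite [X in N X](_ : _ = ((w - z)^-1 * (f w - f z) - l) * (w - z)).
    by rewrite Normc.normcM ler_wpM2r// normc_ge0.
  by field; rewrite subr_eq0.
case=> l H; apply/cvg_ex; exists l; apply/HP => e /H[d d0 Hd].
rewrite near_withinE; apply/nbhs_normcP; exists d => // w; rewrite subr0 => wd w0.
rewrite /= /GRing.scale /= mulr1 -(ler_pM2r (x := N w)) ?normc_gt0// -Normc.normcM.
have := Hd (w + z); rewrite addrK => /(_ wd); apply: le_trans.
by rewrite le_eqVlt; apply/orP; left; apply/eqP; congr N; field.
Qed.

(** Carathéodory's form of differentiability: the slope is a function defined everywhere and
    continuous at [z]. It gives the chain rule without dividing by increments, and later allows a
    series to be differentiated by summing slopes. *)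
Lemma derivable_slopeP (f : R[i]^o -> R[i]^o) (z : R[i]^o) :
  derivable f z 1 <-> exists2 s : R[i]^o -> R[i]^o,
    {for z, continuous s} & forall w, f w - f z = s w * (w - z).
Proof.
rewrite derivable_normcP; split.
  case=> l H; pose s w : R[i]^o := if w == z then l else (f w - f z) / (w - z).
  exists s; last first.
    move=> w; rewrite /s; have [->|wz] := eqVneq w z; first by rewrite !subrr mulr0.
    by rewrite mulfVK// subr_eq0.
  apply/continuous_normcP => e e0; have [d d0 Hd] := H e e0; exists d => // w /Hd.
  rewrite /s eqxx; have [->|wz] := eqVneq w z.
    by rewrite !subrr Normc.normc0 (ltW e0).
  rewrite [X in N X](_ : _ = ((f w - f z) / (w - z) - l) * (w - z)).
    by rewrite Normc.normcM ler_pM2r// normc_gt0 subr_eq0.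
  by field; rewrite subr_eq0.
case=> s /continuous_normcP cs H; exists (s z) => e /cs[d d0 Hd]; exists d => // w /Hd.
by rewrite H -mulrBl Normc.normcM => ?; rewrite ler_wpM2r// normc_ge0.
Qed.

Lemma derivable_continuous (f : R[i]^o -> R[i]^o) (z : R[i]^o) :
  derivable f z 1 -> {for z, continuous f}.
Proof. by move=> /derivable1_diffP/differentiable_continuous. Qed.

End Modulus.

(** * Rules of complex differentiation and the principal square root *)

Section HolomorphicCalculus.
Variable R : realType.
Implicit Types (f g : R[i]^o -> R[i]^o) (z w : R[i]^o).

Lemma lerB_normc z w : N z - N w <= N (z - w).
Proof. by rewrite lerBlDr; have := normcD (z - w) w; rewrite subrK. Qed.

Lemma derivable_mulc f g z : derivable f z 1 -> derivable g z 1 ->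
  derivable (fun w => f w * g w) z 1.
Proof. exact: derivableM. Qed.

Lemma derivable_subc f g z : derivable f z 1 -> derivable g z 1 ->
  derivable (fun w => f w - g w) z 1.
Proof. exact: derivableB. Qed.

Lemma derivable_addc f g z : derivable f z 1 -> derivable g z 1 ->
  derivable (fun w => f w + g w) z 1.
Proof. exact: derivableD. Qed.

Lemma derivable_invc f z : f z != 0 -> derivable f z 1 ->
  derivable (fun w => (f w)^-1) z 1.
Proof. exact: derivableV. Qed.

Lemma derivable_constc (a : R[i]) z : derivable (fun=> a : R[i]^o) z 1.
Proof. exact: derivable_cst. Qed.

Lemma derivable_subcst (a : R[i]) z : derivable (fun w => w - a : R[i]^o) z 1.
Proof. by apply: derivable_subc; [exact: derivable_id|exact: derivable_constc]. Qed.

Lemma derivable_compc f g z : derivable f z 1 -> derivable g (f z) 1 ->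
  derivable (fun w => g (f w)) z 1.
Proof.
move=> df /derivable_slopeP[t ct Ht].
have cf := derivable_continuous df; move/derivable_slopeP : df => [s cs Hs].
apply/derivable_slopeP; exists (fun w => t (f w) * s w); last first.
  by move=> w; rewrite Ht Hs mulrA.
exact: (@cvgM _ _ (nbhs z) _ _ _ _ _ (cvg_comp f t cf ct) cs).
Qed.

Lemma re_sqrtc_gt0 (w : R[i]) : 0 < re w -> 0 < re (sqrtc w).
Proof.
case: w => a b /= a0; rewrite sqrtr_gt0 divr_gt0// ltr_wpDl// sqrtr_ge0.
Qed.

Lemma re_sqrtc_ge0 (w : R[i]) : 0 <= re (sqrtc w).
Proof. by case: w => a b /=; exact: sqrtr_ge0. Qed.

Lemma re_le_normc (w : R[i]) : re w <= N w.
Proof. exact: le_trans (ler_norm _) (ler_Re_normc _). Qed.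

(** In [u ^+ 2 - 1 = (u - 1) * (u + 1)] the second factor has real part, hence modulus, at least 1.
    Estimates near 1 thus pass from a number to its square root in the right half plane. *)
Lemma normc_sub1_sqr (u : R[i]) : 0 <= re u -> N (u - 1) <= N (u ^+ 2 - 1).
Proof.
move=> u0; have -> : u ^+ 2 - 1 = (u - 1) * (u + 1) by ring.
rewrite Normc.normcM ler_peMr ?normc_ge0//.
by apply: le_trans (re_le_normc _); rewrite ReD lerDr.
Qed.

Lemma re_gt0_normc_sub1 (u : R[i]) : N (u - 1) < 1 -> 0 < re u.
Proof.
move=> H; have := le_lt_trans (ler_Re_normc _) H.
by rewrite ReB /= ltr_norml => /andP[]; lra.
Qed.

(** Factoring [w - z] through the roots shows that the slope is the inverse of [sqrtc w + sqrtc z].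
    This sum never vanishes, since [sqrtc w] has non-negative real part for every [w]. *)
Lemma derivable_sqrtc z : 0 < re z -> derivable (@sqrtc R : R[i]^o -> R[i]^o) z 1.
Proof.
move=> z0; have sz0 := re_sqrtc_gt0 z0.
have sD w : 0 < re (sqrtc w + sqrtc z) by rewrite ReD ltr_wpDl// re_sqrtc_ge0.
have sN0 w : sqrtc w + sqrtc z != 0.
  by apply/eqP => E; have := sD w; rewrite E ltxx.
have factor w : w - z = (sqrtc w - sqrtc z) * (sqrtc w + sqrtc z).
  by rewrite -[in LHS](sqr_sqrtc w) -[in LHS](sqr_sqrtc z); ring.
apply/derivable_slopeP; exists (fun w => (sqrtc w + sqrtc z)^-1); last first.
  by move=> w; rewrite factor mulrC mulfK.
have csqrt : {for z, continuous (@sqrtc R : R[i]^o -> R[i]^o)}; last first.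
  apply: (@cvgV _ _ (nbhs z) _ (fun w => sqrtc w + sqrtc z : R[i]^o) _ (sN0 z)).
  exact: (@cvgD _ _ _ (nbhs z) _ _ _ _ _ csqrt (@cvg_cst _ _ _ (nbhs z) _)).
(* The factor [sqrtc w + sqrtc z] has modulus at least [re (sqrtc z)], so the roots differ by at
   most [N (w - z)] divided by this number. *)
apply/continuous_normcP => e e0; exists (e * re (sqrtc z)); first by rewrite mulr_gt0.
move=> w; rewrite factor Normc.normcM => H.
rewrite -(ler_pM2r sz0) ltW//; apply: le_lt_trans H.
rewrite ler_wpM2l ?normc_ge0//; apply: le_trans (re_le_normc _).
by rewrite ReD lerDr re_sqrtc_ge0.
Qed.

End HolomorphicCalculus.

(** * Square roots with a small cut *)

Section SquareRootBranch.
Variables (R : realType) (K : set R[i]^o) (z0 : R[i]) (r : R).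

(** The domain required of a branch. Its complement, the part of the open disc of radius [r] lying
    off [K], is all the room left for the cut. *)
Definition off_cut (z : R[i]) := K z \/ r <= N (z - z0).

(* A branch of [sqrt ((z - a) / (z - b))] off a cut joining [a] to [b] inside the
   disc of radius [r] about [z0]. *)
Definition sqrt_branch (a b : R[i]) (g : R[i]^o -> R[i]^o) :=
  (forall z, off_cut z -> derivable g z 1 /\ g z ^+ 2 * (z - b) = z - a) /\
  (forall z, 9 * r <= N (z - z0) -> 0 < re (g z)).

(** Here [g z ^+ 2 - 1 = (b - a) / (z - b)], with numerator below [2 * r] and denominator at least
    [8 * r] in modulus; the sign condition selects the root near 1. *)
Lemma sqrt_branch_far a b g (z : R[i]) : 0 < r -> N (a - z0) < r -> N (b - z0) < r ->
  sqrt_branch a b g -> 9 * r <= N (z - z0) -> N (g z - 1) <= 4^-1.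
Proof.
move=> r0 ar br [Hg Hre] zr; apply: le_trans (normc_sub1_sqr (ltW (Hre _ zr))) _.
have [|_ E] := Hg z; first by right; lra.
have zb : 8 * r <= N (z - b).
  have := lerB_normc (z - z0) (b - z0); rewrite opprB addrA subrK; lra.
rewrite -(ler_pM2r (x := N (z - b))); last lra.
rewrite -Normc.normcM mulrBl E mul1r opprB addrC addrA subrK.
have := normcBD (b - z0) (a - z0); rewrite opprB addrA subrK; lra.
Qed.

(** The end [b] of the cut is moved to [b'] by multiplying [g] by the principal root of
    [q z = (z - b) / (z - b')]. The distance hypothesis keeps [q] within 1/8 of 1, hence in the
    right half plane. Far away the factors are within 1/4 and 1/8 of 1, so the product still has
    positive real part. *)
Lemma sqrt_branch_move a b b' g : 0 < r ->
  N (a - z0) < r -> N (b - z0) < r -> N (b' - z0) < r -> ~ off_cut b' ->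
  (forall z, off_cut z -> 8 * N (b' - b) <= N (z - b')) ->
  sqrt_branch a b g -> exists g', sqrt_branch a b' g'.
Proof.
move=> r0 ar br br' nb' Hbb' gP; have [Hg Hre] := gP.
pose q z := (z - b) / (z - b').
have zb' z : off_cut z -> z - b' != 0.
  by move=> zX; apply/eqP => /subr0_eq E; apply: nb'; rewrite -E.
have q1 z : off_cut z -> N (q z - 1) <= 8^-1.
  move=> zX; have zb'0 := zb' _ zX.
  have -> : q z - 1 = (b' - b) / (z - b') by rewrite /q; field.
  rewrite Normc.normcM Normc.normcV ler_pdivrMr ?normc_gt0//.
  have := Hbb' _ zX; lra.
have qre z : off_cut z -> 0 < re (q z).
  by move=> /q1 H; apply: re_gt0_normc_sub1; lra.
exists (fun z => g z * sqrtc (q z)); split=> z zX.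
  have [dg E] := Hg _ zX; split; last first.
    by rewrite exprMn sqr_sqrtc -mulrA mulfVK ?zb'.
  apply: (derivable_mulc (g := fun z => sqrtc (q z)) dg).
  apply: (derivable_compc (f := q) (g := @sqrtc R) _ (derivable_sqrtc (qre _ zX))).
  apply: (derivable_mulc (f := fun z => z - b) (g := fun z => (z - b')^-1)).
    exact: derivable_subcst.
  apply: (derivable_invc (f := fun z => z - b')); last exact: derivable_subcst.
  exact: zb'.
have nz : off_cut z by right; lra.
have g1 := sqrt_branch_far r0 ar br gP zX.
have s1 : N (sqrtc (q z) - 1) <= 8^-1.
  by apply: le_trans (normc_sub1_sqr (re_sqrtc_ge0 _)) _; rewrite sqr_sqrtc q1.
apply: re_gt0_normc_sub1.
have -> : g z * sqrtc (q z) - 1 =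
  (g z - 1) * (sqrtc (q z) - 1) + ((g z - 1) + (sqrtc (q z) - 1)) by ring.
apply: le_lt_trans (normcD _ _) _; rewrite Normc.normcM.
have := normcD (g z - 1) (sqrtc (q z) - 1).
have : N (g z - 1) * N (sqrtc (q z) - 1) <= 4^-1 * 8^-1 by rewrite ler_pM ?normc_ge0.
lra.
Qed.

End SquareRootBranch.

Lemma compact_normc_bounded (R : realType) (K : set R[i]^o) :
  compact K -> exists M : R, forall z, K z -> N z <= M.
Proof.
move=> cK; have [[k Kk]|/set0P] := pselect (K !=set0); last first.
  by move/negP; rewrite negbK => /eqP ->; exists 0.
have [||/= c _ H] := @compact_EVT_max _ R (fun z : R[i]^o => N z) K _ cK.
- by exists k.
- apply/subspace_continuousP => x Kx; apply: cvg_within_filter.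
  apply/cvgrPdist_le => e e0; apply/nbhs_normcP; exists e => // w wx.
  rewrite ler_norml; apply/andP; split.
    rewrite lerNl opprB; exact: le_trans (lerB_normc w x) (ltW wx).
  by apply: le_trans (lerB_normc x w) _; rewrite normcB ltW.
- by exists (N c) => z Kz; apply: H; rewrite inE.
Qed.

(** Suppose that no end of a cut can reach the annulus between [r / 2] and [r]. Then the set [S] of
    ends that can be reached from [a] is open and closed in the complement of [K], hence equal to
    it. But [S] is bounded and the complement of a compact set is not. *)
Lemma exists_sqrt_branch (R : realType) (K : set R[i]^o) (z0 : R[i]) (r : R) (a : R[i]) :
  compact K -> connected (~` K) -> 0 < r -> ~ K a -> N (a - z0) < r / 2 ->
  exists b, [/\ N (b - z0) < r, r / 2 <= N (b - z0) &
    exists g, sqrt_branch K z0 r a b g].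
Proof.
move=> cK cCK r0 nKa ar; apply: contrapT => nex.
have oCK : open (~` K).
  by rewrite openC; apply: compact_closed => //; exact: (@norm_hausdorff _ R[i]^o).
have gap (b : R[i]) : ~ K b -> N (b - z0) < r ->
    exists2 h : R, 0 < h & forall z, off_cut K z0 r z -> h <= N (z - b).
  move=> nKb br; have /nbhs_normcP[e e0 He] := open_nbhs_nbhs (conj oCK nKb).
  exists (Num.min e (r - N (b - z0))); first by rewrite lt_min e0 subr_gt0.
  move=> z [Kz|zr]; rewrite ge_min; apply/orP; [left|right].
    by rewrite leNgt; apply/negP => /He.
  by have := lerB_normc (z - z0) (b - z0); rewrite opprB addrA subrK; lra.
pose S : set R[i]^o := [set b | [/\ ~ K b, N (b - z0) < r / 2 &
  exists g, sqrt_branch K z0 r a b g]].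
(* By [nex] the moved end cannot lie in the annulus, so it stays in the disc of radius [r / 2]. *)
have Smove (b b' : R[i]) (h : R) : S b -> ~ K b' -> N (b' - z0) < r -> 0 < h ->
    (forall z, off_cut K z0 r z -> h <= N (z - b')) -> 8 * N (b' - b) <= h -> S b'.
  move=> [nKb br [g Hg]] nKb' br' h0 Hh bb'.
  have [g' Hg'] : exists g', sqrt_branch K z0 r a b' g'.
    apply: (sqrt_branch_move r0 _ _ _ _ _ Hg) => //; try lra.
      by move=> /Hh; rewrite subrr Normc.normc0; lra.
    by move=> z /Hh; lra.
  split => //; last by exists g'.
  rewrite ltNge; apply/negP => br2; apply: nex; exists b'; split => //.
  by exists g'.
have S_ball (b : R[i]) : ~ K b -> N (b - z0) < r -> exists2 h : R, 0 < h &
    forall b', N (b' - b) < h -> ~ K b' /\ N (b' - z0) < r /\ (S b' <-> S b).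
  move=> nKb br; have [h h0 Hh] := gap b nKb br.
  (* Points within [h / 9] of [b] keep a gap [8 / 9 * h], eight times that radius, so the end can be
     moved from [b] to [b'] and also back. Membership in [S] is therefore locally constant, which
     gives both openness and closedness. *)
  exists (h / 9); first by rewrite divr_gt0.
  move=> b' bb'.
  have b'gap z : off_cut K z0 r z -> 8 / 9 * h <= N (z - b').
    move=> /Hh; have := lerB_normc (z - b) (b' - b); rewrite opprB addrA subrK; lra.
  have nb' : ~ off_cut K z0 r b'.
    by move=> /b'gap; rewrite subrr Normc.normc0; lra.
  have nKb' : ~ K b' by move=> Kb'; apply: nb'; left.
  have b'r : N (b' - z0) < r by rewrite ltNge; apply/negP => H; apply: nb'; right.
  split => //; split => //; split => Sb.
    by apply: (Smove b' b h) => //; rewrite normcB; lra.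
  by apply: (Smove b b' (8 / 9 * h)) => //; lra.
have S_all : S = ~` K.
  apply: cCK.
  (* The degenerate cut with [b = a] has the constant branch 1. *)
  - exists a; split => //; exists (fun=> 1); split => z _ /=; last exact: ltr01.
    by split; [exact: derivable_constc|rewrite expr1n mul1r].
  - exists S; last by apply/seteqP; split => [b Sb|b []//]; split => //; case: Sb.
    rewrite openE => b Sb; have [nKb br _] := Sb.
    have [|h h0 Hh] := S_ball b nKb _; first lra.
    by apply/nbhs_normcP; exists h => // w /Hh [_ [_ ->]].
  - exists (closure S); first exact: closed_closure.
    apply/seteqP; split => [b Sb|b [nKb clb]].
      by split; [case: Sb|exact: subset_closure].
    have br : N (b - z0) < r.
      have [] := clb [set w : R[i]^o | N (w - b) < r / 2].
        by apply/nbhs_normcP; exists (r / 2) => //; rewrite divr_gt0.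
      move=> w [[_ wr _] /= wb].
      by have := lerB_normc (b - z0) (w - z0); rewrite opprB addrA subrK (normcB b w); lra.
    have [h h0 Hh] := S_ball b nKb br.
    have [] := clb [set w : R[i]^o | N (w - b) < h].
      by apply/nbhs_normcP; exists h.
    by move=> w [Sw /= /Hh [_ [_ <-]]].
have [M HM] := compact_normc_bounded cK.
(* A point too large to lie in [K] or in the disc of radius [r] about [z0]. *)
pose w : R[i] := (`|M| + N z0 + r)%:C.
have Nw : N w = `|M| + N z0 + r.
  by rewrite normcR ger0_norm// !addr_ge0 ?normc_ge0// ltW.
have MM := ler_norm M; have z00 := normc_ge0 z0.
have : S w by rewrite S_all => /HM; rewrite Nw; lra.
move=> [_ + _]; have := lerB_normc w z0; rewrite Nw; have := normr_ge0 M; lra.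
Qed.

(** * Estimates for a single peaking function at scale [r] *)

Section PeakingFunctions.
Variables (R : realType) (z0 a b : R[i]) (r : R).

(** Taking [a] within [r / 4] while [b] is at least [r / 2] away from [z0] makes [N (b - a)]
    comparable to [r]. *)
Definition cut_ends :=
  [/\ 0 < r, N (a - z0) < r / 4, N (b - z0) < r & r / 2 <= N (b - z0)].

(* [peaking (g z) z] equals [1 - 4 (z - z0) / ((z - b) (1 + g z)^2)] when
   [g z ^+ 2 * (z - b) = z - a]; it tends to [0] at infinity. *)
Definition peaking (u z : R[i]) : R[i] := 1 - 4 * (z - z0) * (u - 1) / ((b - a) * (1 + u)).

Lemma cut_ends_dist : cut_ends -> r / 4 <= N (b - a) <= 5 / 4 * r.
Proof.
move=> [r0 ar br br2]; have := lerB_normc (b - z0) (a - z0).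
have := normcBD (b - z0) (a - z0); rewrite opprB addrA subrK => H1 H2.
by apply/andP; split; lra.
Qed.

Lemma cut_ends_neq0 : cut_ends -> b - a != 0.
Proof.
by move=> H; have /andP[] := cut_ends_dist H; rewrite -normc_gt0; case: H; lra.
Qed.

Section Branch.
Variables u z : R[i].
Hypothesis E : u ^+ 2 * (z - b) = z - a.

(** As [b - a] is nonzero, this identity excludes both [u = -1] and [z = b]; the size of its factors
    governs all the estimates below. *)
Lemma branch_sqr_sub1 : (u - 1) * (u + 1) * (z - b) = b - a.
Proof.
have -> : (u - 1) * (u + 1) * (z - b) = u ^+ 2 * (z - b) - (z - b) by ring.
by rewrite E; ring.
Qed.

Lemma branch_add1_neq0 : cut_ends -> 1 + u != 0.
Proof.
move=> /cut_ends_neq0 ab; apply/eqP => u1; have := ab.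
by rewrite -branch_sqr_sub1 [u + 1]addrC u1 mulr0 mul0r eqxx.
Qed.

Lemma branch_subb_neq0 : cut_ends -> z - b != 0.
Proof.
move=> /cut_ends_neq0 ab; apply/eqP => zb; have := ab.
by rewrite -branch_sqr_sub1 zb mulr0 eqxx.
Qed.

End Branch.

(** No sign of [u] is known here, so [1 + u] must be kept away from 0 otherwise. By
    [branch_sqr_sub1], [N (u - 1) * N (u + 1)] is at least [(r / 4) / (10 * r)], that is 1/40. If
    [N (u + 1)] were below 1/120, then [N (u - 1)] would be at most 3 and the product too small.
    Hence the quotient of the two is at most 241, and [4 * 241 * 4] is below 4000. *)
Lemma peaking_near (u z : R[i]) : cut_ends -> u ^+ 2 * (z - b) = z - a -> N (z - z0) <= 9 * r ->
  N (peaking u z - 1) * r <= 4000 * N (z - z0).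
Proof.
move=> ab; have [r0 ar br br2] := ab; have ab0 := cut_ends_neq0 ab.
have /andP[ab_ge ab_le] := cut_ends_dist ab.
move=> E zr; have u1 := branch_add1_neq0 E ab; have zb := branch_subb_neq0 E ab.
have zbr : N (z - b) <= 10 * r.
  by have := normcBD (z - z0) (b - z0); rewrite opprB addrA subrK; lra.
have uu : 40^-1 <= N (u - 1) * N (u + 1).
  have : r / 4 <= N (u - 1) * N (u + 1) * N (z - b) by rewrite -!Normc.normcM (branch_sqr_sub1 E).
  have : N (u - 1) * N (u + 1) * N (z - b) <= N (u - 1) * N (u + 1) * (10 * r).
    by rewrite ler_wpM2l// mulr_ge0 ?normc_ge0.
  by move=> H1 H2; rewrite -(ler_pM2r r0); lra.
have two : N (2 : R[i]) = 2 by rewrite normc_nat.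
have uu' : N (u - 1) <= 241 * N (1 + u).
  rewrite [1 + u]addrC.
  have H : N (u - 1) <= N (u + 1) + 2.
    have -> : u - 1 = (u + 1) - 2 by ring.
    by rewrite -two normcBD.
  have [ge|lt] := leP (120^-1) (N (u + 1)); first lra.
  suff : N (u - 1) * N (u + 1) < 40^-1 by lra.
  apply: (@le_lt_trans _ _ (3 * N (u + 1))); last lra.
  by rewrite ler_wpM2r ?normc_ge0//; lra.
have -> : peaking u z - 1 = - (4 * (z - z0) * (u - 1) / ((b - a) * (1 + u))).
  by rewrite /peaking; ring.
rewrite normcN !Normc.normcM Normc.normcV Normc.normcM.
have -> : N (4 : R[i]) = 4 by rewrite normc_nat.
rewrite mulrAC ler_pdivrMr; last by rewrite mulr_gt0 ?normc_gt0.
have Z := normc_ge0 (z - z0); have D : 0 < N (1 + u) by rewrite normc_gt0.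
have : N (u - 1) * r <= 241 * N (1 + u) * (4 * N (b - a)).
  by rewrite ler_pM ?normc_ge0 ?(ltW r0)//; lra.
move=> H; have := ler_wpM2l Z H.
have : 0 <= N (z - z0) * N (1 + u) * N (b - a) by rewrite !mulr_ge0 ?normc_ge0.
lra.
Qed.

(** After multiplication by [(z - b) * (1 + u) ^+ 2] the terms growing with [z] cancel, leaving
    three terms of total size at most [8 * r]. Since [re u] is positive, [1 + u] has modulus at
    least 1 and can be divided out. *)
Lemma peaking_far (u z : R[i]) : cut_ends -> u ^+ 2 * (z - b) = z - a -> 0 < re u ->
  9 * r <= N (z - z0) -> N (peaking u z) * N (z - z0) <= 9 * r.
Proof.
move=> ab; have [r0 ar br br2] := ab; have ab0 := cut_ends_neq0 ab.
have /andP[ab_ge ab_le] := cut_ends_dist ab.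
move=> E u0 zr; have u1 := branch_add1_neq0 E ab; have zb := branch_subb_neq0 E ab.
have zbr : 8 / 9 * N (z - z0) <= N (z - b).
  by have := lerB_normc (z - z0) (b - z0); rewrite opprB addrA subrK; lra.
have u1_ge1 : 1 <= N (1 + u) by apply: le_trans (re_le_normc _); rewrite ReD /= lerDl ltW.
have num : peaking u z * ((z - b) * (1 + u) ^+ 2) =
    4 * (z0 - b) + 2 * ((u - 1) * (z - b)) + (u ^+ 2 - 1) * (z - b).
  have -> : peaking u z * ((z - b) * (1 + u) ^+ 2) =
    (z - b) * (1 + u) ^+ 2 - 4 * (z - z0) * (((u - 1) * (u + 1) * (z - b)) / (b - a)).
    by rewrite /peaking; field; rewrite ab0.
  by rewrite (branch_sqr_sub1 E)// divff// ; ring.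
have subsq : N ((u ^+ 2 - 1) * (z - b)) <= 5 / 4 * r.
  by rewrite subr_sqr_1 (branch_sqr_sub1 E).
have sub1 : N ((u - 1) * (z - b)) <= 5 / 4 * r.
  apply: le_trans subsq; rewrite !Normc.normcM ler_wpM2r ?normc_ge0//.
  exact: normc_sub1_sqr (ltW u0).
have H : N (peaking u z) * N (z - b) <= 8 * r.
  apply: (@le_trans _ _ (N (peaking u z * ((z - b) * (1 + u) ^+ 2)))).
    rewrite (Normc.normcM (peaking u z)) (Normc.normcM (z - b)) normcX.
    rewrite ler_wpM2l ?normc_ge0// ler_peMr ?normc_ge0//.
    by rewrite exprn_ege1.
  rewrite num; apply: le_trans (normcD _ _) _.
  have := normcD (4 * (z0 - b)) (2 * ((u - 1) * (z - b))).
  rewrite !(Normc.normcM 4) !(Normc.normcM 2) !normc_nat (normcB z0); lra.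
have := ler_wpM2l (normc_ge0 (peaking u z)) zbr; lra.
Qed.

(** With [q x = (x - z0) / (x - b)] the function is [1 - 4 * q * (1 + u) ^- 2]. Both [q] and [u] are
    Lipschitz with constant [1 / d] in this region, while [q] and [(1 + u)^-1] are bounded by 2 and
    1. The constant 4000 is merely the one of [peaking_near]. *)
Lemma peaking_lipschitz (u v z w : R[i]) (d : R) : cut_ends ->
  u ^+ 2 * (z - b) = z - a -> v ^+ 2 * (w - b) = w - a ->
  0 < re u -> 0 < re v -> 9 * r <= d -> d <= N (z - z0) -> d <= N (w - z0) ->
  N (peaking u z - peaking v w) * d <= 4000 * N (z - w).
Proof.
move=> ab; have [r0 ar br br2] := ab; have ab0 := cut_ends_neq0 ab.
have /andP[ab_ge ab_le] := cut_ends_dist ab.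
move=> Eu Ev u0 v0 rd dz dw.
have u1 := branch_add1_neq0 Eu ab; have zb := branch_subb_neq0 Eu ab.
have v1 := branch_add1_neq0 Ev ab; have wb := branch_subb_neq0 Ev ab.
have far (x y : R[i]) : y ^+ 2 * (x - b) = x - a -> 0 < re y -> d <= N (x - z0) ->
    8 / 9 * d <= N (x - b) /\ N (y - 1) <= 4^-1.
  move=> E y0 dx; have H : 8 / 9 * d <= N (x - b).
    by have := lerB_normc (x - z0) (b - z0); rewrite opprB addrA subrK; lra.
  split => //; apply: le_trans (normc_sub1_sqr (ltW y0)) _.
  rewrite -(ler_pM2r (x := N (x - b))); last lra.
  by rewrite -Normc.normcM subr_sqr_1 (branch_sqr_sub1 E)//; lra.
have [zbd u14] := far z u Eu u0 dz; have [wbd v14] := far w v Ev v0 dw.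
have Z := normc_ge0 (z - w).
have d0 : 0 < d by lra.
have bb : d ^+ 2 <= 81 / 64 * (N (z - b) * N (w - b)).
  have : (8 / 9 * d) * (8 / 9 * d) <= N (z - b) * N (w - b) by rewrite ler_pM//; lra.
  by rewrite expr2; lra.
have zbp : 0 < N (z - b) by lra.
have wbp : 0 < N (w - b) by lra.
have re_ge (x : R[i]) : N (x - 1) <= 4^-1 -> 3 / 4 <= re x.
  move=> H; have := le_trans (ler_Re_normc _) H.
  by rewrite ReB /= ler_norml => /andP[]; lra.
(* The difference of squares [u ^+ 2 - v ^+ 2] is explicit, and [u + v] has modulus at least 1
   because both roots are within 1/4 of 1. *)
have uv : N (u - v) * d <= N (z - w).
  have : N (u - v) <= N ((u - v) * (u + v)).
    rewrite Normc.normcM ler_peMr ?normc_ge0//; apply: le_trans (re_le_normc _).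
    by rewrite ReD; have := re_ge _ u14; have := re_ge _ v14; lra.
  have -> : (u - v) * (u + v) = (b - a) * (w - z) / ((z - b) * (w - b)).
    apply: (canRL (mulfK _)); first by rewrite mulf_neq0.
    have -> : (u - v) * (u + v) * ((z - b) * (w - b)) =
      u ^+ 2 * (z - b) * (w - b) - v ^+ 2 * (w - b) * (z - b) by ring.
    by rewrite Eu Ev; ring.
  rewrite !Normc.normcM Normc.normcV Normc.normcM (normcB w) ler_pdivlMr ?mulr_gt0// => H.
  have {}H : N (u - v) * d ^+ 2 <= 81 / 64 * (N (b - a) * N (z - w)).
    by have := ler_wpM2l (normc_ge0 (u - v)) bb; lra.
  rewrite -(ler_pM2r d0) -mulrA -expr2; apply: le_trans H _.
  have : N (b - a) * N (z - w) <= 5 / 36 * d * N (z - w) by rewrite ler_wpM2r//; lra.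
  by have := mulr_ge0 Z (ltW d0); lra.
pose q (x : R[i]) := (x - z0) / (x - b).
have q1 (x : R[i]) : x - b != 0 -> 8 / 9 * d <= N (x - b) -> N (q x) <= 2.
  move=> x0 xd; rewrite Normc.normcM Normc.normcV ler_pdivrMr; last lra.
  have := normcD (x - b) (b - z0); rewrite addrA subrK; lra.
have qq : N (q z - q w) * d <= N (z - w).
  have -> : q z - q w = (b - z0) * (w - z) / ((z - b) * (w - b)).
    by rewrite /q; field; rewrite zb wb.
  rewrite !Normc.normcM Normc.normcV Normc.normcM mulrAC ler_pdivrMr ?mulr_gt0// (normcB w).
  rewrite -(ler_pM2r d0) -!mulrA -expr2.
  have : N (z - w) * d ^+ 2 <= N (z - w) * (81 / 64 * (N (z - b) * N (w - b))) by rewrite ler_wpM2l.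
  move=> H; have : N (b - z0) * (N (z - w) * d ^+ 2) <=
     d / 9 * (N (z - w) * (81 / 64 * (N (z - b) * N (w - b)))).
    by apply: ler_pM => //; rewrite ?mulr_ge0 ?exprn_ge0 ?normc_ge0 ?(ltW d0)//; lra.
  have : 0 <= N (z - w) * N (z - b) * N (w - b) * d by rewrite !mulr_ge0 ?normc_ge0// ltW.
  lra.
have p1 (x : R[i]) : 0 < re x -> N (1 + x)^-1 <= 1.
  move=> x0; rewrite Normc.normcV invf_le1; last first.
    by apply: lt_le_trans (re_le_normc _); rewrite ReD /=; lra.
  by apply: le_trans (re_le_normc _); rewrite ReD /=; lra.
have pp : N ((1 + u)^-1 - (1 + v)^-1) <= N (u - v).
  have -> : (1 + u)^-1 - (1 + v)^-1 = (v - u) * ((1 + u)^-1 * (1 + v)^-1).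
    by field; rewrite u1 v1.
  rewrite Normc.normcM (normcB v) ler_piMr ?normc_ge0// Normc.normcM.
  by rewrite mulr_ile1 ?normc_ge0 ?p1.
have form (x y : R[i]) : y ^+ 2 * (x - b) = x - a -> peaking y x = 1 - 4 * (q x * (1 + y)^-1 ^+ 2).
  move=> E; have y1 := branch_add1_neq0 E ab; have xb := branch_subb_neq0 E ab.
  rewrite /peaking /q -(branch_sqr_sub1 E); field.
  rewrite y1 xb /=.
  by have := ab0; rewrite -(branch_sqr_sub1 E) !mulf_eq0 !negb_or => /andP[/andP[]].
rewrite (form _ _ Eu) (form _ _ Ev).
have -> : 1 - 4 * (q z * (1 + u)^-1 ^+ 2) - (1 - 4 * (q w * (1 + v)^-1 ^+ 2)) =
  - 4 * ((q z - q w) * (1 + u)^-1 ^+ 2 +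
    q w * ((1 + u)^-1 - (1 + v)^-1) * ((1 + u)^-1 + (1 + v)^-1)) by ring.
rewrite Normc.normcM normcN normc_nat.
have sm : N ((1 + u)^-1 + (1 + v)^-1) <= 2.
  by apply: le_trans (normcD _ _) _; have := p1 _ u0; have := p1 _ v0; lra.
have A : N ((q z - q w) * (1 + u)^-1 ^+ 2) <= N (q z - q w).
  by rewrite (Normc.normcM (q z - q w)) normcX ler_piMr ?normc_ge0// exprn_ile1 ?normc_ge0 ?p1.
have B : N (q w * ((1 + u)^-1 - (1 + v)^-1) * ((1 + u)^-1 + (1 + v)^-1)) <= 2 * N (u - v) * 2.
  rewrite 2!Normc.normcM; apply: ler_pM => //; try exact: normc_ge0.
    by rewrite mulr_ge0 ?normc_ge0.
  by apply: ler_pM pp => //; [exact: normc_ge0|exact: normc_ge0|exact: q1].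
have := le_trans (normcD _ _) (lerD A B) => /(ler_wpM2r (ltW d0)); lra.
Qed.

End PeakingFunctions.

(** What matters is that [C] does not depend on [r]: functions of many scales can then be
    superposed. *)
Lemma exists_peaking (R : realType) (K : set R[i]^o) (z0 : R[i]) :
  compact K -> connected (~` K) -> closure (~` K) z0 ->
  exists2 C : R, 0 < C & forall r : R, 0 < r -> exists G : R[i]^o -> R[i]^o,
    [/\ forall z, K z -> derivable G z 1,
    forall z, K z -> N (z - z0) <= 9 * r -> N (G z - 1) * r <= C * N (z - z0),
    forall z, K z -> 9 * r <= N (z - z0) -> N (G z) * N (z - z0) <= 9 * r &
    forall z w d, K z -> K w -> 9 * r <= d -> d <= N (z - z0) -> d <= N (w - z0) ->
      N (G z - G w) * d <= C * N (z - w)].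
Proof.
move=> cK cCK clz0; exists 4000; [by rewrite ltr0n|move=> r r0].
have [a [nKa /= ar]] : ~` K `&` [set a : R[i]^o | N (a - z0) < r / 4] !=set0.
  by apply: clz0; apply/nbhs_normcP; exists (r / 4) => //; rewrite divr_gt0.
have [|b [br br2 [g [Hg Hre]]]] := exists_sqrt_branch cK cCK r0 nKa (z0 := z0); first lra.
have ab : cut_ends z0 a b r by split.
exists (fun z => peaking z0 a b (g z) z); split.
- move=> z Kz; have [dg E] := Hg z (or_introl Kz).
  rewrite /peaking.
  apply: (derivable_subc (f := fun=> 1)); first exact: derivable_constc.
  apply: (derivable_mulc (f := fun z => 4 * (z - z0) * (g z - 1))
    (g := fun z => ((b - a) * (1 + g z))^-1)).
    apply: (derivable_mulc (f := fun z => 4 * (z - z0)) (g := fun z => g z - 1)).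
      apply: (derivable_mulc (f := fun=> 4)); first exact: derivable_constc.
      exact: derivable_subcst.
    apply: (derivable_subc (g := fun=> 1) dg); exact: derivable_constc.
  apply: (derivable_invc (f := fun z => (b - a) * (1 + g z))).
    apply: mulf_neq0; first exact: (cut_ends_neq0 ab).
    exact: (branch_add1_neq0 E ab).
  apply: (derivable_mulc (f := fun=> b - a)); first exact: derivable_constc.
  apply: (derivable_addc (f := fun=> 1) _ dg); exact: derivable_constc.
- by move=> z Kz zr; have [_ E] := Hg z (or_introl Kz); exact: peaking_near.
- move=> z Kz zr; have [_ E] := Hg z (or_introl Kz); apply: peaking_far => //.
  exact: Hre.
- move=> z w d Kz Kw rd dz dw.
  have [_ E] := Hg z (or_introl Kz); have [_ E'] := Hg w (or_introl Kw).
  by apply: (peaking_lipschitz ab E E') => //; apply: Hre; apply: le_trans rd _.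
Qed.

(** Completeness in the form used twice below: to sum a series with explicit error, and to find the
    limit point of a bisection. *)
Lemma nested_intervals (R : realType) (x y : nat -> R) :
  (forall n, x n <= x n.+1) -> (forall n, y n.+1 <= y n) -> (forall n, x n <= y n) ->
  exists s, forall n, x n <= s <= y n.
Proof.
move=> xS yS xy.
have xm : {homo x : m n / (m <= n)%N >-> m <= n} by exact/nondecreasing_seqP.
have ym : {homo y : m n / (m <= n)%N >-> n <= m} by exact/nonincreasing_seqP.
have xub n : ubound (range x) (y n).
  move=> _ [m _ <-]; apply: (@le_trans _ _ (x (maxn m n))); first by rewrite xm ?leq_maxl.
  by apply: le_trans (xy _) _; rewrite ym ?leq_maxr.
have x0 : range x !=set0 by exists (x 0%N); exists 0%N.
exists (sup (range x)) => n; apply/andP; split; last by apply: ge_sup.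
apply: sup_upper_bound; last by exists n.
by split => //; exists (y 0%N); exact: xub.
Qed.

(** * Geometrically weighted series *)

Section GeometricSeries.
Variables (R : realType) (l : R).
Implicit Types (a : nat -> R[i]) (M : R).

(** The full series of weights [(1 - l) * l ^+ n] has sum 1, and its tail from [k] on is
    [l ^+ k]. *)
Definition geo_psum a (k : nat) : R[i] := \sum_(n < k) ((1 - l) * l ^+ n)%:C * a n.

Lemma geo_psumS a k : geo_psum a k.+1 = geo_psum a k + ((1 - l) * l ^+ k)%:C * a k.
Proof. by rewrite /geo_psum big_ord_recr. Qed.

(* The sum of [(1 - l) l^n a_n], meaningful when [M] bounds all the [N (a_n)]. *)
Definition geo_sum M a : R[i] :=
  xget 0 [set s | forall k, N (s - geo_psum a k) <= 2 * M * l ^+ k].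

(** The tail of the weights makes the intervals of radius [M * l ^+ k] about the partial sums
    nested; [s] is a common point. *)
Lemma real_geo_sum (u : nat -> R) M : 0 < l < 1 -> (forall n, `|u n| <= M) ->
  exists s, forall k, `|s - \sum_(n < k) (1 - l) * l ^+ n * u n| <= M * l ^+ k.
Proof.
move=> /andP[l0 l1] uM; pose S k := \sum_(n < k) (1 - l) * l ^+ n * u n.
have step k : `|(1 - l) * l ^+ k * u k| <= M * l ^+ k - M * l ^+ k.+1.
  have L : 0 <= (1 - l) * l ^+ k by rewrite mulr_ge0 ?exprn_ge0 ?subr_ge0 ?ltW.
  rewrite normrM ger0_norm//.
  have -> : M * l ^+ k - M * l ^+ k.+1 = (1 - l) * l ^+ k * M by rewrite exprS; ring.
  by rewrite ler_wpM2l.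
have [|||s Hs] := @nested_intervals R (fun k => S k - M * l ^+ k) (fun k => S k + M * l ^+ k).
- move=> k; have := step k; rewrite /S big_ord_recr /= ler_norml => /andP[]; lra.
- move=> k; have := step k; rewrite /S big_ord_recr /= ler_norml => /andP[]; lra.
- move=> k; have := le_trans (normr_ge0 _) (uM 0%N) => M0.
  have : 0 <= M * l ^+ k by rewrite mulr_ge0// exprn_ge0// ltW.
  lra.
- exists s => k; have /andP[] := Hs k; rewrite -/(S k) ler_norml => *.
  by apply/andP; split; lra.
Qed.

(** The real and imaginary parts are summed separately and each contributes an error [M * l ^+ k],
    whence the factor 2. *)
Lemma geo_sumP M a k : 0 < l < 1 -> (forall n, N (a n) <= M) ->
  N (geo_sum M a - geo_psum a k) <= 2 * M * l ^+ k.
Proof.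
move=> l01 aM; suff [s Hs] : exists s, forall k, N (s - geo_psum a k) <= 2 * M * l ^+ k.
  by rewrite /geo_sum; case: xgetP => [_ -> /(_ k)//|/(_ s)[]].
have [x Hx] := real_geo_sum l01 (fun n => le_trans (ler_Re_normc (a n)) (aM n)).
have [y Hy] := real_geo_sum l01 (fun n => le_trans (ler_Im_normc (a n)) (aM n)).
have psumE j : geo_psum a j =
    (\sum_(n < j) (1 - l) * l ^+ n * re (a n)) +i* (\sum_(n < j) (1 - l) * l ^+ n * im (a n)).
  elim: j => [|j ih]; first by rewrite /geo_psum !big_ord0.
  rewrite geo_psumS ih !big_ord_recr /=; case: (a j) => p q /=.
  by simpc.
exists (x +i* y) => j; apply: le_trans (normc_le_ReIm _) _.
by rewrite psumE /=; have := Hx j; have := Hy j; lra.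
Qed.

Lemma expr_lt_eps (C e : R) : 0 < l < 1 -> 0 < e ->
  exists k0, forall k, (k0 <= k)%N -> C * l ^+ k < e.
Proof.
move=> /andP[l0 l1] e0.
have : (fun k => C * l ^+ k) x @[x --> \oo] --> C * 0.
  by apply: cvgMr; apply: cvg_expr; rewrite ger0_norm// ltW.
rewrite mulr0 => /cvgr_lt /(_ _ e0) [k0 _ H]; exists k0 => k kk.
exact: H.
Qed.

Lemma le_expr_le (C x y : R) : 0 < l < 1 -> (forall k, x <= y + C * l ^+ k) -> x <= y.
Proof.
move=> l01 H; rewrite leNgt; apply/negP; rewrite -subr_gt0 => xy.
have [k /(_ k (leqnn k))] := expr_lt_eps C l01 xy.
by have := H k; lra.
Qed.

Lemma cvg_geo_psum {T} (F : set_system T) (FF : Filter F) (a : T -> nat -> R[i]) b k :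
  (forall n, (fun x => a x n : R[i]^o) @ F --> (b n : R[i]^o)) ->
  (fun x => geo_psum (a x) k : R[i]^o) @ F --> (geo_psum b k : R[i]^o).
Proof.
move=> ab; elim: k => [|k ih].
  rewrite /geo_psum big_ord0.
  rewrite [X in X @ _ --> _](_ : _ = fun=> 0); first exact: cvg_cst.
  by apply/funext => x; rewrite big_ord0.
rewrite geo_psumS [X in X @ _ --> _](_ : _ = fun x => geo_psum (a x) k +
  ((1 - l) * l ^+ k)%:C * a x k); last by apply/funext => x; rewrite geo_psumS.
have cM := @cvgM (R[i] : numFieldType) T F FF (fun=> ((1 - l) * l ^+ k)%:C) (fun x => a x k) _ _
  (@cvg_cst _ _ _ F FF) (ab k).
exact: (@cvgD _ (R[i]^o : normedModType R[i]) T F FF _ _ _ _ ih cM).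
Qed.

Lemma cvg_geo_sum {T} (F : set_system T) (FF : Filter F) M (a : T -> nat -> R[i]) b :
  0 < l < 1 -> (\forall x \near F, forall n, N (a x n) <= M) -> (forall n, N (b n) <= M) ->
  (forall n, (fun x => a x n : R[i]^o) @ F --> (b n : R[i]^o)) ->
  (fun x => geo_sum M (a x) : R[i]^o) @ F --> (geo_sum M b : R[i]^o).
Proof.
move=> l01 aM bM ab; apply/cvg_normcP => e e0.
have e3 : 0 < e / 3 by rewrite divr_gt0.
have [k /(_ k (leqnn k)) Hk] := expr_lt_eps (2 * M) l01 e3.
have /cvg_normcP/(_ _ e3) := cvg_geo_psum (k := k) FF ab.
apply: filterS2 aM => x xM Hx.
have -> : geo_sum M (a x) - geo_sum M b = (geo_sum M (a x) - geo_psum (a x) k) +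
  (geo_psum (a x) k - geo_psum b k) - (geo_sum M b - geo_psum b k) by ring.
apply: le_trans (normcBD _ _) _; have := geo_sumP k l01 bM; have := geo_sumP k l01 xM.
have := normcD (geo_sum M (a x) - geo_psum (a x) k) (geo_psum (a x) k - geo_psum b k).
lra.
Qed.

(** Bishop's estimate: only the term [m] is allowed to be large, and its weighted size is at most
    [l ^+ m / 4]. The terms before it contribute at most [(1 - l ^+ m) * (1 + l ^+ m / 4)], those
    after it at most [l ^+ m.+1 / 4]. The total stays below 1 by at least [l ^+ m / 4]. *)
Lemma geo_sum_lt1 M a m : 0 < l < 1 -> (1 - l) * M <= 4^-1 -> (forall n, N (a n) <= M) ->
  (forall j, (j < m)%N -> N (a j) <= 1 + l ^+ m / 4) ->
  (forall j, (m < j)%N -> N (a j) <= 4^-1) -> N (geo_sum M a) < 1.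
Proof.
move=> l01 lM aM alt agt; have /andP[l0 l1] := l01.
have lk k : 0 < l ^+ k by rewrite exprn_gt0.
have wN k (A : R) : N (a k) <= A -> N (((1 - l) * l ^+ k)%:C * a k) <= (1 - l) * l ^+ k * A.
  have L : 0 <= (1 - l) * l ^+ k by rewrite mulr_ge0 ?exprn_ge0 ?subr_ge0 ?ltW.
  by move=> H; rewrite Normc.normcM normcR ger0_norm// ler_wpM2l.
have H1 k : (k <= m)%N -> N (geo_psum a k) <= (1 - l ^+ k) * (1 + l ^+ m / 4).
  elim: k => [_|k ih km]; first by rewrite /geo_psum big_ord0 expr0 subrr mul0r Normc.normc0.
  rewrite geo_psumS; apply: le_trans (normcD _ _) _.
  by have := ih (ltnW km); have := wN _ _ (alt _ km); rewrite exprS; lra.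
have H2 j : N (geo_psum a (m.+1 + j)) <= 1 - l ^+ m / 4.
  suff : N (geo_psum a (m.+1 + j)) <= 1 - l ^+ m / 2 + (l ^+ m.+1 - l ^+ (m.+1 + j)) / 4.
    move/le_trans; apply; have := lk (m.+1 + j)%N.
    have : l ^+ m.+1 <= l ^+ m by rewrite exprS ler_piMl ?ltW.
    lra.
  elim: j => [|j ih].
    rewrite addn0 geo_psumS subrr mul0r addr0; apply: le_trans (normcD _ _) _.
    have := H1 m (leqnn m); have := wN _ _ (aM m).
    have := ler_wpM2l (ltW (lk m)) lM; have := mulr_ge0 (ltW (lk m)) (ltW (lk m)).
    lra.
  rewrite addnS geo_psumS; apply: le_trans (normcD _ _) _.
  have := wN _ _ (agt (m.+1 + j)%N _); rewrite ltnS leq_addr => /(_ isT).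
  by rewrite (exprS l (m.+1 + j)); lra.
(* The margin [l ^+ m / 4] is uniform in the number of terms, so it survives a truncation error
   below [l ^+ m / 8]. *)
have e0 : 0 < l ^+ m / 8 by rewrite divr_gt0.
have [k Hk] := expr_lt_eps (2 * M) l01 e0.
have {}Hk := Hk (m.+1 + k)%N (leq_addl _ _).
have := normcD (geo_sum M a - geo_psum a (m.+1 + k)) (geo_psum a (m.+1 + k)).
rewrite subrK; have := H2 k; have := geo_sumP (m.+1 + k) l01 aM; lra.
Qed.

End GeometricSeries.

Lemma derivable_near_slope (R : realType) (f s : R[i]^o -> R[i]^o) (z : R[i]^o) :
  {for z, continuous s} -> (\forall w \near z, f w - f z = s w * (w - z)) ->
  derivable f z 1.
Proof.
move=> /continuous_normcP cs /nbhs_normcP[d0 d0_gt0 H]; apply/derivable_normcP.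
exists (s z) => e /cs[d d_gt0 Hd]; exists (Num.min d0 d); first by rewrite lt_min d0_gt0.
move=> w; rewrite lt_min => /andP[/H -> /Hd He].
by rewrite -mulrBl Normc.normcM ler_wpM2r ?normc_ge0.
Qed.

Lemma geo_psum_slope (R : realType) (l : R) (x y s : nat -> R[i]) (h : R[i]) k :
  (forall n, x n - y n = s n * h) -> geo_psum l x k - geo_psum l y k = geo_psum l s k * h.
Proof.
move=> H; elim: k => [|k ih]; first by rewrite /geo_psum !big_ord0 subrr mul0r.
by rewrite !geo_psumS [RHS]mulrDl -ih -mulrA -H; ring.
Qed.

(** The identity is exact for partial sums; the three truncation errors are [O(l ^+ k)] for every
    [k], so the difference vanishes. *)
Lemma geo_sum_slope (R : realType) (l M M' : R) (x y s : nat -> R[i]) (h : R[i]) :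
  0 < l < 1 -> (forall n, N (x n) <= M) -> (forall n, N (y n) <= M) ->
  (forall n, N (s n) <= M') -> (forall n, x n - y n = s n * h) ->
  geo_sum l M x - geo_sum l M y = geo_sum l M' s * h.
Proof.
move=> l01 xM yM sM H; apply/eqP; rewrite -subr_eq0 -normc_eq0 eq_le normc_ge0 andbT.
apply: (le_expr_le (C := 4 * M + 2 * M' * N h) l01) => k.
have -> : geo_sum l M x - geo_sum l M y - geo_sum l M' s * h =
  (geo_sum l M x - geo_psum l x k) - (geo_sum l M y - geo_psum l y k) -
  (geo_sum l M' s - geo_psum l s k) * h.
  by rewrite [in RHS]mulrBl -(geo_psum_slope l k H); ring.
apply: le_trans (normcBD _ _) _; rewrite Normc.normcM.
have := normcBD (geo_sum l M x - geo_psum l x k) (geo_sum l M y - geo_psum l y k).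
have := geo_sumP k l01 xM; have := geo_sumP k l01 yM.
have := ler_wpM2r (normc_ge0 h) (geo_sumP k l01 sM).
lra.
Qed.

(* Weierstrass' theorem on uniform limits, in a case where Lipschitz bounds make
   it elementary. *)
Lemma derivable_geo_sum (R : realType) (l M : R) (G : nat -> R[i]^o -> R[i]^o)
    (z : R[i]^o) (B : R) (n0 : nat) : 0 < l < 1 ->
  (\forall w \near z, forall n, N (G n w) <= M) ->
  (forall n, derivable (G n) z 1) ->
  (\forall w \near z, forall n, (n0 <= n)%N -> N (G n w - G n z) <= B * N (w - z)) ->
  derivable (fun w => geo_sum l M (fun n => G n w) : R[i]^o) z 1.
Proof.
move=> l01 GM dG GB.
have /choice[s Hs] n : exists s : R[i]^o -> R[i]^o,
    {for z, continuous s} /\ forall w, G n w - G n z = s w * (w - z).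
  by have /derivable_slopeP[s] := dG n; exists s.
have s_near n e : 0 < e -> \forall w \near z, N (s n w - s n z) <= e.
  by move=> e0; have /continuous_normcP/(_ e e0) := (Hs n).1 => /nbhs_normcP.
(* The Lipschitz bound controls [s n] only off [z]. Its value at [z] is compared, by continuity,
   with that at a point at distance [e / 2]. *)
have big n : (n0 <= n)%N -> N (s n z) <= B + 1.
  move=> nn; have : \forall w \near z, N (s n w - s n z) <= 1 /\ N (G n w - G n z) <= B * N (w - z).
    apply: filterS2 GB (s_near n 1 ltr01) => w H1 H2; split => //; exact: H1.
  move=> /nbhs_normcP[e e0 /(_ (z + (e / 2)%:C))].
  have Ne : N (z + (e / 2)%:C - z) = e / 2 by rewrite addrC addKr normcR ger0_norm//; lra.
  rewrite Ne; case; first lra.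
  rewrite (Hs n).2 Normc.normcM Ne ler_pM2r; last lra.
  by rewrite normcB => ? ?; have := lerB_normc (s n z) (s n (z + (e / 2)%:C)); lra.
have sB : exists M', \forall w \near z, forall n, N (s n w) <= M'.
  have [B' HB'] : exists B', forall n, (n < n0)%N -> N (s n z) <= B'.
    elim: (n0) => [|k [b Hb]]; first by exists 0.
    exists (Num.max b (N (s k z))) => n; rewrite ltnS leq_eqVlt => /orP[/eqP ->|/Hb H].
      by rewrite le_max lexx orbT.
    by rewrite le_max H.
  have [B2 HB2] : exists B2, \forall w \near z, forall n, (n < n0)%N -> N (s n w) <= B2.
    exists (B' + 1); move: HB'; elim: (n0) => [_|k ih H]; first by apply/nbhs_normcP; exists 1.
    have : \forall w \near z, forall n, (n < k)%N -> N (s n w) <= B' + 1.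
      by apply: ih => n nk; apply: H; rewrite ltnS ltnW.
    move=> ihk; apply: filterS2 ihk (s_near k 1 ltr01) => w Hw Hk n.
    rewrite ltnS leq_eqVlt => /orP[/eqP ->|/Hw//].
    have := lerB_normc (s k w) (s k z); have := H k (ltnSn k); lra.
  exists (Num.max B2 (B + 1)); apply: filterS2 HB2 GB => w H1 H2 n; rewrite le_max.
  have [nn|/H1 ->//] := leqP n0 n; apply/orP; right.
  have [->|wz] := eqVneq w z; first exact: big.
  have := H2 n nn; rewrite (Hs n).2 Normc.normcM ler_pM2r ?normc_gt0 ?subr_eq0//; lra.
have [M' HM'] := sB.
have zM := nbhs_singleton GM; have szM := nbhs_singleton HM'.
apply: (@derivable_near_slope _ _ (fun w => geo_sum l M' (fun n => s n w))).
  exact: (cvg_geo_sum (a := fun w n => s n w) (b := fun n => s n z) (F := nbhs z)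
    _ l01 HM' szM (fun n => (Hs n).1)).
apply: filterS2 GM HM' => w wM swM; apply: geo_sum_slope => // n.
exact: (Hs n).2.
Qed.

(** * Bishop's construction of a peak function at a boundary point *)

(** The ratio of consecutive radii is itself geometric, so that at scale [m] the earlier functions
    differ from 1 by only a small multiple of [l ^+ m], as [geo_sum_lt1] requires. *)
Fixpoint peak_radius (R : realType) (c l : R) (n : nat) : R :=
  if n is m.+1 then peak_radius c l m * (c * l ^+ n) else 1.

Lemma peak_radius_gt0 (R : realType) (c l : R) n : 0 < c -> 0 < l -> 0 < peak_radius c l n.
Proof. by move=> c0 l0; elim: n => [|n ih] //=; rewrite !mulr_gt0 ?exprn_gt0. Qed.

Lemma peak_radius_le (R : realType) (c l : R) m n : 0 < c <= 1 -> 0 < l < 1 -> (m <= n)%N ->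
  peak_radius c l n <= peak_radius c l m.
Proof.
move=> /andP[c0 c1] /andP[l0 l1].
suff rm : {homo peak_radius c l : m n / (m <= n)%N >-> n <= m} by exact: rm.
apply/nonincreasing_seqP => {m}n /=.
by rewrite ler_piMr ?mulr_ile1 ?exprn_ile1 ?exprn_ge0// ltW ?peak_radius_gt0.
Qed.

Lemma peak_radius_small (R : realType) (c l e : R) : 0 < c <= 1 -> 0 < l < 1 -> 0 < e ->
  exists n, peak_radius c l n < e.
Proof.
move=> /andP[c0 c1] l01 e0; have /andP[l0 l1] := l01.
have [n /(_ n (leqnn n)) Hn] := expr_lt_eps 1 l01 e0.
exists n; apply: le_lt_trans Hn; rewrite mul1r.
have cl k : 0 <= c * l ^+ k.+1 <= l.
  have lkl : l ^+ k.+1 <= l by rewrite exprS ler_piMr ?(ltW l0)// exprn_ile1 ?ltW.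
  have lk0 : 0 <= l ^+ k.+1 by rewrite exprn_ge0 ?ltW.
  rewrite mulr_ge0 ?(ltW c0)//=; apply: le_trans lkl.
  by rewrite ler_piMl.
elim: n => [|n ih]; first by rewrite expr0.
rewrite /= [leRHS]exprSr; have /andP[cl0 cll] := cl n; have r0 := ltW (peak_radius_gt0 n c0 l0).
exact: ler_pM r0 cl0 ih cll.
Qed.

(** Each [w] other than [z0] has at most one function of the series at its own scale: the earlier
    ones are still close to 1 at [w], the later ones already small. *)
Lemma boundary_peak_point (R : realType) (K : set R[i]^o) (z0 : R[i]^o) :
  compact K -> connected (~` K) -> K z0 -> closure (~` K) z0 ->
  peak_point K (algebraA K) z0.
Proof.
move=> cK cCK Kz0 clz0; split => //.
have [C C0 HC] := exists_peaking cK cCK clz0.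
(* A bound for all the functions on [K]: they are within [9 * C] of 1 near [z0], and at most 1 in
   modulus elsewhere. *)
have [M HM] : exists M : R, 9 * C + 1 <= M by exists (9 * C + 1).
have [l [l01 lM]] : exists l : R, 0 < l < 1 /\ (1 - l) * M <= 4^-1.
  have M0 : 0 < M by lra.
  exists (1 - (4 * M)^-1); split; last first.
    by rewrite opprB addrC subrK invfM -mulrA mulVf ?mulr1// gt_eqF.
  have : 0 < (4 * M)^-1 < 1 by rewrite invr_gt0 invf_lt1 ?mulr_gt0//=; lra.
  by move=> /andP[? ?]; apply/andP; split; lra.
have /andP[l0 l1] := l01.
(* The bound 1/4 turns [N (w - z0) < 36 * r m] into [N (w - z0) <= 9 * r j] for [j < m], where the
   near estimate applies; the bound on [C * 36 * c] then makes that estimate at most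
   [l ^+ m / 4]. *)
have [c [c01 c4]] : exists c : R, 0 < c <= 4^-1 /\ C * 36 * c <= 4^-1.
  have C36 : 0 < C * 36 by lra.
  exists (Num.min 4^-1 (4 * (C * 36))^-1); rewrite lt_min !invr_gt0 ltr0n mulr_gt0//.
  rewrite ge_min lexx; split => //.
  apply: (@le_trans _ _ (C * 36 * (4 * (C * 36))^-1)).
    by rewrite ler_pM2l// ge_min lexx orbT.
  by rewrite invfM mulrCA mulfV ?mulr1// gt_eqF.
have /andP[c0 c14] := c01.
have {}c01 : 0 < c <= 1 by rewrite c0; lra.
pose r := peak_radius c l; have r0 n : 0 < r n := peak_radius_gt0 n c0 l0.
have rle m n : (m <= n)%N -> r n <= r m := @peak_radius_le _ c l m n c01 l01.
have /choice[G HG] n := HC (r n) (r0 n).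
have dG z n : K z -> derivable (G n) z 1 by case: (HG n) => + _ _ _; apply.
have G1 z n : K z -> N (z - z0) <= 9 * r n -> N (G n z - 1) * r n <= C * N (z - z0).
  by case: (HG n) => _ + _ _; apply.
have Gfar z n : K z -> 9 * r n <= N (z - z0) -> N (G n z) * N (z - z0) <= 9 * r n.
  by case: (HG n) => _ _ + _; apply.
have GL n z w d : K z -> K w -> 9 * r n <= d -> d <= N (z - z0) -> d <= N (w - z0) ->
      N (G n z - G n w) * d <= C * N (z - w).
  by case: (HG n) => _ _ _; apply.
have GM z : K z -> forall n, N (G n z) <= M.
  move=> Kz n; have rn := r0 n; have [zr|zr] := leP (9 * r n) (N (z - z0)).
    have z_gt0 : 0 < N (z - z0) by lra.
    suff : N (G n z) <= 1 by lra.
    rewrite -(ler_pM2r z_gt0); have := Gfar z n Kz zr; lra.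
  have : N (G n z - 1) <= 9 * C.
    rewrite -(ler_pM2r rn); have := G1 z n Kz (ltW zr).
    by have := ler_wpM2l (ltW C0) (ltW zr); lra.
  by have := lerB_normc (G n z) 1; rewrite Normc.normc1; lra.
exists (fun z => geo_sum l M (fun n => G n z)); split.
- split.
    apply/subspace_continuousP => z Kz.
    apply: (cvg_geo_sum (a := fun w n => G n w) (b := fun n => G n z) _ l01 _ (GM z Kz)).
      rewrite near_withinE; exact: nearW.
    by move=> n; apply: cvg_within_filter; apply: derivable_continuous; exact: dG.
  move=> z Kiz; have Kz := interior_subset Kiz.
  have zz0 : z != z0.
    by apply/eqP => E; move: Kiz; rewrite E => /clz0[w [nKw /nKw]].
  (* Within [d] of [z] all points are at distance at least [d] from [z0], so the Lipschitz bound
     [C / d] holds for all [n] with [9 * r n <= d]. *)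
  pose d := N (z - z0) / 2.
  have d0 : 0 < d by rewrite divr_gt0// normc_gt0 subr_eq0.
  have [n0 Hn0] := peak_radius_small c01 l01 (divr_gt0 d0 (ltr0n R 9)).
  apply: (@derivable_geo_sum _ _ _ G z (C / d) n0 l01).
  + by apply: filterS Kiz => w Kw n; exact: GM.
  + by move=> n; exact: dG.
  + have /nbhs_normcP[e e0 He] := Kiz.
    apply/nbhs_normcP; exists (Num.min e d); first by rewrite lt_min e0.
    move=> w; rewrite lt_min => /andP[/He Kw wd] n nn.
    rewrite mulrAC ler_pdivlMr//; apply: GL => //.
    * by have := rle _ _ nn; rewrite /r; lra.
    * have := lerB_normc (z - z0) (z - w); rewrite (normcB z w).
      have -> : z - z0 - (z - w) = w - z0 by ring.
      by move: wd; rewrite /d; lra.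
    * by move: d0; rewrite /d; lra.
- apply/eqP; rewrite -subr_eq0 -normc_eq0 eq_le normc_ge0 andbT.
  have G0 n : G n z0 = 1.
    apply/eqP; rewrite -subr_eq0 -normc_eq0 eq_le normc_ge0 andbT -(ler_pM2r (r0 n)).
    have := G1 z0 n Kz0; rewrite subrr Normc.normc0 mulr0 mul0r; apply.
    by rewrite mulr_ge0// ltW.
  have psum1 k : geo_psum l (fun n => G n z0) k = (1 - l ^+ k)%:C.
    elim: k => [|k ih]; first by rewrite /geo_psum big_ord0 expr0 subrr.
    by rewrite geo_psumS ih G0 mulr1 -rmorphD/= exprS; congr (_%:C); ring.
  apply: (le_expr_le (C := 2 * M + 1) l01) => k.
  have := geo_sumP k l01 (GM z0 Kz0); rewrite psum1 => H.
  have := normcBD (geo_sum l M (fun n => G n z0) - (1 - l ^+ k)%:C) (l ^+ k)%:C.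
  rewrite normcR ger0_norm ?exprn_ge0 ?(ltW l0)// rmorphB/= rmorph1.
  have -> : geo_sum l M (fun n => G n z0) - (1 - (l ^+ k)%:C) - (l ^+ k)%:C =
    geo_sum l M (fun n => G n z0) - 1 by ring.
  by move: H; rewrite rmorphB/= rmorph1; lra.
- move=> w [Kw /= /eqP wz0]; rewrite normr_normc (ltcR _ 1).
  have z_gt0 : 0 < N (w - z0) by rewrite normc_gt0 subr_eq0.
  have ex : exists n, 36 * r n <= N (w - z0).
    have [n Hn] := peak_radius_small c01 l01 (divr_gt0 z_gt0 (ltr0n R 36)).
    by exists n; rewrite /r; lra.
  case: (ex_minnP ex) => n Hn nmin.
  (* From [n] on, the functions are at most [9 / 36] at [w]; the exceptional index is the one
     before. When [n] is 0 the predecessor is 0 too, and no earlier index has to be checked. *)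
  apply: (@geo_sum_lt1 _ l M _ n.-1) => //.
  + exact: GM.
  + move=> j; case: n Hn nmin => [//|m] _ nmin /= jm.
    have wm : N (w - z0) < 36 * r m.
      by rewrite ltNge; apply/negP => /nmin; rewrite ltnn.
    have rm : r m <= r j * (c * l ^+ m).
      case: m jm {nmin wm} => // m jm; rewrite /r [leLHS]/= ler_wpM2r//.
        by rewrite mulr_ge0 ?exprn_ge0 ?ltW.
      by apply: rle; rewrite -ltnS.
    have rj := r0 j; have lm : l ^+ m <= 1 by rewrite exprn_ile1// ltW.
    have rjc : r j * (c * l ^+ m) <= r j * 4^-1.
      rewrite ler_wpM2l ?(ltW rj)//; apply: le_trans c14.
      by rewrite ler_piMr// ltW.
    have rjl : r j * l ^+ m <= r j by rewrite ler_piMr// ltW.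
    have Cw := ler_wpM2l (ltW C0) (ltW wm); have Cr := ler_wpM2l (ltW C0) rm.
    have cr : C * 36 * c * (r j * l ^+ m) <= 4^-1 * (r j * l ^+ m).
      by rewrite ler_wpM2r// mulr_ge0 ?exprn_ge0 ?(ltW rj) ?(ltW l0).
    have : N (G j w - 1) <= l ^+ m / 4.
      rewrite -(ler_pM2r rj); have wj : N (w - z0) <= 9 * r j by lra.
      by have := G1 w j Kw wj; lra.
    by have := lerB_normc (G j w) 1; rewrite Normc.normc1; lra.
  + move=> j nj; have rj := r0 j.
    have rjn : r j <= r n by apply: rle; case: (n) nj => [|m]//; rewrite ltnS.
    by rewrite -(ler_pM2r z_gt0); have := Gfar w j Kw; lra.
Qed.

(** * Goursat's lemma for Riemann sums *)

Section Goursat.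
Variable R : realType.
Implicit Types (F : R[i]^o -> R[i]^o) (p v : R[i]) (s : R).

(* Left Riemann sum of [F] along the segment [p, p + v], with [2^n] steps. *)
Fixpoint riemann_sum F (n : nat) p v : R[i] :=
  if n is m.+1 then riemann_sum F m p (v / 2) + riemann_sum F m (p + v / 2) (v / 2)
  else v * F p.

(** Discrete contour integral, counterclockwise for positive [v]: bottom and right sides, minus top
    and left. *)
Definition square_sum F n p v : R[i] :=
  riemann_sum F n p v + riemann_sum F n (p + v) ('i * v)
  - riemann_sum F n (p + 'i * v) v - riemann_sum F n p ('i * v).

(** Dyadic sums over adjacent squares use the same sample points on their common side, so the inner
    sides cancel exactly. *)
Lemma square_sumS F n p v (h := v / 2) : square_sum F n.+1 p v =
  square_sum F n p h + square_sum F n (p + h) h + square_sum F n (p + 'i * h) h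
  + square_sum F n (p + h + 'i * h) h.
Proof.
rewrite /square_sum /=.
have -> : 'i * v / 2 = 'i * h by rewrite mulrA.
have -> : p + v = p + h + h by rewrite /h; field.
have -> : p + 'i * v = p + 'i * h + 'i * h by rewrite /h; field.
rewrite -/h.
have -> : p + h + h + 'i * h = p + h + 'i * h + h by ring.
have -> : p + 'i * h + 'i * h + h = p + h + 'i * h + 'i * h by ring.
have -> : p + 'i * h + h = p + h + 'i * h by ring.
ring.
Qed.

Lemma riemann_sum_le F n p v B : (forall t : R, 0 <= t <= 1 -> N (F (p + t%:C * v)) <= B) ->
  N (riemann_sum F n p v) <= N v * B.
Proof.
elim: n p v => [|n ih] p v H /=.
  rewrite Normc.normcM ler_wpM2l ?normc_ge0//.
  by have := H 0; rewrite mul0r addr0; apply; rewrite lexx ler01.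
have v2 : N (v / 2) = N v / 2 by rewrite Normc.normcM Normc.normcV normc_nat.
apply: le_trans (normcD _ _) _.
have -> : N v * B = N (v / 2) * B + N (v / 2) * B by rewrite v2; field.
apply: lerD; apply: ih => t /andP[t0 t1].
  have -> : t%:C * (v / 2) = (t / 2)%:C * v by rewrite rmorphM/= fmorphV rmorph_nat; ring.
  by apply: H; apply/andP; split; lra.
have -> : p + v / 2 + t%:C * (v / 2) = p + ((1 + t) / 2)%:C * v.
  by rewrite rmorphM/= fmorphV rmorph_nat rmorphD rmorph1; ring.
by apply: H; apply/andP; split; lra.
Qed.

Lemma re_riemann_sum_ge F n p (v c : R) : 0 <= v ->
  (forall t : R, 0 <= t <= 1 -> c <= re (F (p + (t * v)%:C))) ->
  v * c <= re (riemann_sum F n p v%:C).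
Proof.
elim: n p v => [|n ih] p v v0 H /=.
  have -> : re (v%:C * F p) = v * re (F p) by case: (F p) => a b /=; rewrite mul0r subr0.
  by rewrite ler_wpM2l//; have := H 0; rewrite mul0r addr0; apply; rewrite lexx ler01.
have -> : v%:C / 2 = (v / 2)%:C :> R[i] by rewrite rmorphM/= fmorphV rmorph_nat.
have v20 : 0 <= v / 2 by lra.
rewrite ReD; have -> : v * c = v / 2 * c + v / 2 * c by field.
apply: lerD; apply: ih => // t /andP[t0 t1].
  have -> : t * (v / 2) = t / 2 * v by ring.
  by apply: H; apply/andP; split; lra.
have -> : p + (v / 2)%:C + (t * (v / 2))%:C = p + ((1 + t) / 2 * v)%:C.
  by rewrite -addrA -rmorphD/=; congr (_ + _%:C); ring.
by apply: H; apply/andP; split; lra.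
Qed.

Lemma riemann_sumD F G n p v :
  riemann_sum (fun z => F z + G z) n p v = riemann_sum F n p v + riemann_sum G n p v.
Proof. by elim: n p v => [|n ih] p v /=; rewrite ?mulrDr// !ih; ring. Qed.

Lemma square_sumD F G n p v :
  square_sum (fun z => F z + G z) n p v = square_sum F n p v + square_sum G n p v.
Proof. by rewrite /square_sum !riemann_sumD; ring. Qed.

(** Translation by [w] changes every value by [l * w]. Opposite sides of a square then compensate
    exactly, with no passage to the limit. *)
Lemma riemann_sum_affine (c l : R[i]) n p v w :
  riemann_sum (fun z => c + l * z) n (p + w) v - riemann_sum (fun z => c + l * z) n p v = l * w * v.
Proof.
elim: n p v => [|n ih] p v /=; first by ring.
have -> : p + w + v / 2 = p + v / 2 + w by ring.
by rewrite opprD addrACA !ih -mulrDr -splitr.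
Qed.

Lemma square_sum_affine (c l : R[i]) n p v : square_sum (fun z => c + l * z) n p v = 0.
Proof.
rewrite /square_sum.
have -> (x y z w : R[i]) : x + y - z - w = (y - w) - (z - x) by ring.
by rewrite !riemann_sum_affine; ring.
Qed.

Definition in_square p s (z : R[i]) :=
  (re p <= re z <= re p + s) /\ (im p <= im z <= im p + s).

Lemma square_sum_le F n p s B : 0 <= s ->
  (forall z, in_square p s z -> N (F z) <= B) -> N (square_sum F n p s%:C) <= 4 * s * B.
Proof.
move=> s0 H; rewrite /square_sum.
have Ns : N (s%:C : R[i]) = s by rewrite normcR ger0_norm.
have Nis : N ('i * s%:C : R[i]) = s.
  by rewrite Normc.normcM Ns /= expr0n expr1n add0r sqrtr1 mul1r.
have st t : 0 <= t <= 1 -> 0 <= t * s <= s.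
  by move=> /andP[t0 t1]; rewrite mulr_ge0//= ler_piMl.
have H1 : N (riemann_sum F n p s%:C) <= s * B.
  rewrite -[X in X * B]Ns; apply: riemann_sum_le => t /st /andP[? ?]; apply: H.
  by case: (p) => a b; rewrite /in_square /=; simpc => /=; split; apply/andP; split; lra.
have H2 : N (riemann_sum F n (p + s%:C) ('i * s%:C)) <= s * B.
  rewrite -[X in X * B]Nis; apply: riemann_sum_le => t /st /andP[? ?]; apply: H.
  by case: (p) => a b; rewrite /in_square /=; simpc => /=; split; apply/andP; split; lra.
have H3 : N (riemann_sum F n (p + 'i * s%:C) s%:C) <= s * B.
  rewrite -[X in X * B]Ns; apply: riemann_sum_le => t /st /andP[? ?]; apply: H.
  by case: (p) => a b; rewrite /in_square /=; simpc => /=; split; apply/andP; split; lra.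
have H4 : N (riemann_sum F n p ('i * s%:C)) <= s * B.
  rewrite -[X in X * B]Nis; apply: riemann_sum_le => t /st /andP[? ?]; apply: H.
  by case: (p) => a b; rewrite /in_square /=; simpc => /=; split; apply/andP; split; lra.
apply: le_trans (normcBD _ _) _.
have := normcBD (riemann_sum F n p s%:C + riemann_sum F n (p + s%:C) ('i * s%:C))
   (riemann_sum F n (p + 'i * s%:C) s%:C).
have := normcD (riemann_sum F n p s%:C) (riemann_sum F n (p + s%:C) ('i * s%:C)).
lra.
Qed.

(** The affine part of [F] at [z] contributes 0. The remainder is at most [e / 8 * (2 * s)] on sides
    of total length [4 * s], for every number [n] of halvings. *)
Lemma square_sum_local F (z : R[i]) (e : R) : derivable F z 1 -> 0 < e ->
  exists2 d : R, 0 < d & forall n p s, 0 <= s -> 2 * s < d -> in_square p s z ->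
    N (square_sum F n p s%:C) <= e * s ^+ 2.
Proof.
move=> /derivable_normcP[l Hl] e0; have e8 : 0 < e / 8 by lra.
have [d d0 Hd] := Hl _ e8; exists d => // n p s s0 sd pz.
pose E w := F w - F z - l * (w - z).
have -> : square_sum F n p s%:C = square_sum E n p s%:C.
  have FE : F = fun w => (F z - l * z + l * w) + E w.
    by apply/funext => w; rewrite /E; ring.
  by rewrite [in LHS]FE square_sumD square_sum_affine add0r.
have -> : e * s ^+ 2 = 4 * s * (e / 8 * (2 * s)) by field.
apply: square_sum_le => // w pw.
have wz : N (w - z) <= 2 * s.
  apply: le_trans (normc_le_ReIm _) _.
  have [/andP[? ?] /andP[? ?]] := pz; have [/andP[? ?] /andP[? ?]] := pw.
  have -> : re (w - z) = re w - re z by case: (w); case: (z).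
  have -> : im (w - z) = im w - im z by case: (w); case: (z).
  have : `|re w - re z| <= s by rewrite ler_norml; apply/andP; split; lra.
  have : `|im w - im z| <= s by rewrite ler_norml; apply/andP; split; lra.
  lra.
apply: le_trans (Hd w (le_lt_trans wz sd)) _.
by rewrite ler_wpM2l// ltW.
Qed.

(** Goursat's bisection, where a square is good if its sums are eventually at most [e] times its
    area. Four good quarters make a good square, so a bad square contains a nested sequence of bad
    ones, contradicting [square_sum_local] at their common point. *)
Lemma goursat F p s e : 0 < s -> 0 < e -> (forall z, in_square p s z -> derivable F z 1) ->
  exists n0, forall n, (n0 <= n)%N -> N (square_sum F n p s%:C) <= e * s ^+ 2.
Proof.
move=> s0 e0 dF; apply: contrapT => bad0.
pose good p s := exists n0, forall n, (n0 <= n)%N -> N (square_sum F n p s%:C) <= e * s ^+ 2.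
(* The witness is asserted even for good squares, so that a choice function on all pairs can be
   extracted. *)
have step q t : 0 <= t -> exists q', ~ good q t ->
    [/\ ~ good q' (t / 2), re q <= re q' <= re q + t / 2 & im q <= im q' <= im q + t / 2].
  move=> t0; have [gq|bq] := pselect (good q t); first by exists q.
  apply: contrapT => nex; apply: bq.
  have sub q' : re q <= re q' <= re q + t / 2 -> im q <= im q' <= im q + t / 2 -> good q' (t / 2).
    by move=> H1 H2; apply: contrapT => bq'; apply: nex; exists q'.
  pose h : R[i] := (t / 2)%:C.
  have [n1 H1] : good q (t / 2) by apply: sub; apply/andP; split; lra.
  have [n2 H2] : good (q + h) (t / 2).
    by apply: sub; rewrite /h; case: (q) => a b /=; apply/andP; split; lra.
  have [n3 H3] : good (q + 'i * h) (t / 2).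
    by apply: sub; rewrite /h; case: (q) => a b /=; simpc => /=; apply/andP; split; lra.
  have [n4 H4] : good (q + h + 'i * h) (t / 2).
    by apply: sub; rewrite /h; case: (q) => a b /=; simpc => /=; apply/andP; split; lra.
  (* One halving is spent in passing to the quarters, hence the successor. *)
  exists (maxn (maxn n1 n2) (maxn n3 n4)).+1 => -[//|n]; rewrite ltnS !geq_max.
  move=> /andP[/andP[/H1 {}H1 /H2 {}H2] /andP[/H3 {}H3 /H4 {}H4]].
  have th : t%:C / 2 = h by rewrite /h rmorphM/= fmorphV rmorph_nat.
  rewrite square_sumS th; apply: le_trans (normcD _ _) _.
  have := normcD (square_sum F n q h + square_sum F n (q + h) h) (square_sum F n (q + 'i * h) h).
  have := normcD (square_sum F n q h) (square_sum F n (q + h) h).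
  have -> : e * t ^+ 2 = e * (t / 2) ^+ 2 *+ 4 by rewrite -mulr_natr; field.
  lra.
have sk k : 0 <= s / 2 ^+ k by rewrite divr_ge0 ?exprn_ge0// ltW.
have /choice[f Hf] (x : nat * R[i]) := step x.2 (s / 2 ^+ x.1) (sk x.1).
pose q := fix q k := if k is m.+1 then f (m, q m) else p.
have bad k : ~ good (q k) (s / 2 ^+ k).
  elim: k => [|k ih] /=; first by rewrite expr0 divr1.
  by have [/= + _ _] := Hf (k, q k) ih; rewrite exprSr invfM mulrA.
have half k : s / 2 ^+ k.+1 = s / 2 ^+ k / 2 by rewrite exprSr invfM mulrA.
have qre k : re (q k) <= re (q k.+1) <= re (q k) + s / 2 ^+ k.+1.
  by rewrite half; have [/=] := Hf (k, q k) (bad k).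
have qim k : im (q k) <= im (q k.+1) <= im (q k) + s / 2 ^+ k.+1.
  by rewrite half; have [/=] := Hf (k, q k) (bad k).
have [x Hx] : exists x, forall k, re (q k) <= x <= re (q k) + s / 2 ^+ k.
  apply: nested_intervals => k.
  - by have /andP[] := qre k.
  - by have /andP[_] := qre k; rewrite !half; lra.
  - by rewrite lerDl.
have [y Hy] : exists y, forall k, im (q k) <= y <= im (q k) + s / 2 ^+ k.
  apply: nested_intervals => k.
  - by have /andP[] := qim k.
  - by have /andP[_] := qim k; rewrite !half; lra.
  - by rewrite lerDl.
have dz : derivable F (x +i* y) 1.
  by apply: dF; have := Hx 0%N; have := Hy 0%N; rewrite /= expr0 divr1; split.
have [d d0 Hd] := square_sum_local dz e0.
have half01 : 0 < (2^-1 : R) < 1 by apply/andP; split; lra.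
have [k /(_ k (leqnn k)) Hk] := expr_lt_eps (2 * s) half01 d0.
apply: (bad k); exists 0%N => n _; apply: Hd => //.
by rewrite -exprVn mulrA.
Qed.

End Goursat.

(** * Functions with positive real part, and the exclusion of interior points *)

Section PositiveRealPart.
Variables (R : realType) (u : R[i]^o -> R[i]^o) (z0 : R[i]^o).

(** If the derivative [l] were nonzero, a small step [h] along the opposite of the conjugate of [l]
    would give [re (l * h) = - (N l * N h)], more than the error [N l / 2 * N h] can compensate. *)
Lemma derivable_re_ge0_flat : derivable u z0 1 -> u z0 = 0 ->
  (\forall w \near z0, 0 <= re (u w)) ->
  forall e : R, 0 < e -> exists2 d : R, 0 < d &
    forall w : R[i], N (w - z0) < d -> N (u w) <= e * N (w - z0).
Proof.
move=> /derivable_normcP[l Hl] u0 /nbhs_normcP[d1 d1_gt0 upos].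
have l0 : l = 0.
  apply: contrapT => /eqP l0; have Nl : 0 < N l by rewrite normc_gt0.
  have [d2 d2_gt0 Hd2] := Hl (N l / 2) (divr_gt0 Nl (ltr0n R 2)).
  pose t := Num.min d1 d2 / (2 * N l).
  have d12 : 0 < Num.min d1 d2 by rewrite lt_min d1_gt0.
  have t0 : 0 < t by rewrite divr_gt0// mulr_gt0.
  pose h : R[i] := (- t)%:C * conjc l.
  have Nh : N h = t * N l.
    rewrite Normc.normcM normcR normrN ger0_norm ?(ltW t0)//; congr (_ * _).
    by apply: (@complexI R); rewrite -!normr_normc normcJ.
  have Nhd : N h < Num.min d1 d2.
    by rewrite Nh /t invfM mulrA mulfVK ?gt_eqF//; lra.
  have lh : re (l * h) = - (t * N l ^+ 2).
    by rewrite normc_sqr /h; case: (l) => a b /=; simpc => /=; ring.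
  move: Nhd; rewrite lt_min => /andP[hd1 hd2].
  have hz : z0 + h - z0 = h by rewrite addrC addKr.
  have := Hd2 (z0 + h); rewrite hz u0 subr0 => /(_ hd2) H.
  have := upos (z0 + h); rewrite hz => /(_ hd1) H'.
  have := le_trans (le_trans (ler_norm _) (ler_Re_normc _)) H.
  rewrite ReB lh Nh; have : 0 < t * N l ^+ 2 by rewrite mulr_gt0 ?exprn_gt0.
  lra.
move=> e /Hl[d d0 Hd]; exists d => // w /Hd.
by rewrite u0 l0 mul0r !subr0.
Qed.

Lemma segment_re_ge (p v : R[i]) :
  (forall t : R, 0 <= t <= 1 -> derivable u (p + t%:C * v) 1 /\ 0 < re (u (p + t%:C * v))) ->
  exists2 c : R, 0 < c & forall t : R, 0 <= t <= 1 -> c <= re (u (p + t%:C * v)).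
Proof.
move=> H; pose g (t : R) := re (u (p + t%:C * v)).
have [|c] := @EVT_min R g 0 1 ler01.
  apply/subspace_continuousP => x; rewrite /= in_itv /= => /H[du _].
  apply: cvg_within_filter; apply/cvgrPdist_le => e e0.
  have /continuous_normcP/(_ e e0)[d d0 Hd] := derivable_continuous du.
  have v1 : 0 < N v + 1 by rewrite ltr_wpDl ?normc_ge0.
  apply/nbhs_ballP; exists (d / (N v + 1)); first by rewrite /= divr_gt0.
  move=> t; rewrite -ball_normE /= ltr_pdivlMr// => tx.
  rewrite -ReB; apply: le_trans (ler_Re_normc _) _; rewrite normcB; apply: Hd.
  have -> : p + t%:C * v - (p + x%:C * v) = (t - x)%:C * v by rewrite rmorphB/=; ring.
  rewrite Normc.normcM normcR distrC; apply: le_lt_trans tx.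
  by rewrite ler_wpM2l// lerDl.
rewrite in_itv /= => c01 Hc; exists (g c); first by case: (H c c01).
by move=> t t01; apply: Hc; rewrite in_itv.
Qed.

(** Each halving discards a right half whose sum has non-negative real part; [m] halvings leave [n]
    of the [m + n] for the initial piece. *)
Lemma re_riemann_sum_sub (F : R[i]^o -> R[i]^o) m n p (v : R) : 0 <= v ->
  (forall t : R, 0 <= t <= 1 -> 0 <= re (F (p + (t * v)%:C))) ->
  re (riemann_sum F n p (v / 2 ^+ m)%:C) <= re (riemann_sum F (m + n) p v%:C).
Proof.
elim: m v => [|m ih] v v0 H; first by rewrite expr0 divr1.
have v2 : 0 <= v / 2 by lra.
rewrite addSn /= ReD; have -> : v%:C / 2 = (v / 2)%:C :> R[i].
  by rewrite rmorphM/= fmorphV rmorph_nat.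
rewrite exprS invfM mulrA -[leLHS]addr0; apply: lerD.
  apply: ih => // t /andP[t0 t1].
  have -> : t * (v / 2) = t / 2 * v by ring.
  by apply: H; apply/andP; split; lra.
rewrite -(mulr0 (v / 2)); apply: re_riemann_sum_ge => // t /andP[t0 t1].
have -> : p + (v / 2)%:C + (t * (v / 2))%:C = p + ((1 + t) / 2 * v)%:C.
  by rewrite -addrA -rmorphD/=; congr (_ + _%:C); ring.
by apply: H; apply/andP; split; lra.
Qed.

(* Integrate [1 / (t + u)] around a square with [z0] in the middle of its bottom
   side: the other sides contribute [O(1)] and, as [u] is flat at [z0], the
   bottom contributes arbitrarily much when [t] is small. *)
Lemma re_gt0_not_zero : u z0 = 0 ->
  (\forall w \near z0, derivable u w 1 /\ (w != z0 -> 0 < re (u w))) -> False.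
Proof.
move=> u0 near_u; have /nbhs_normcP[rho rho0 Hu] := near_u.
have re_ge0 w : N (w - z0) < rho -> 0 <= re (u w).
  by move=> /Hu[_]; have [->|_ /(_ isT)/ltW//] := eqVneq w z0; rewrite u0.
have flat := derivable_re_ge0_flat (nbhs_singleton near_u).1 u0 _.
have {}flat : forall e : R, 0 < e -> exists2 d : R, 0 < d &
    forall w : R[i], N (w - z0) < d -> N (u w) <= e * N (w - z0).
  by apply: flat; apply/nbhs_normcP; exists rho.
(* The square of side [2 * r] on this corner has [z0] in the middle of its bottom side; its points
   are within [3 * r < rho] of [z0]. *)
pose r := rho / 4; pose p : R[i] := z0 - r%:C.
have [s sE] : exists s, s = 2 * r by exists (2 * r).
have r0 : 0 < r by rewrite /r; lra.
have s0 : 0 < s by lra.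
have sq_near z : in_square p s z -> N (z - z0) < rho.
  move=> [/andP[z1 z2] /andP[z3 z4]]; apply: le_lt_trans (normc_le_ReIm _) _.
  have : `|re (z - z0)| <= r.
    move: z1 z2; rewrite /p; case: (z) => a b; case: (z0) => c d /= *.
    by rewrite ler_norml; apply/andP; split; lra.
  have : `|im (z - z0)| <= 2 * r.
    move: z3 z4; rewrite /p; case: (z) => a b; case: (z0) => c d /= *.
    by rewrite ler_norml; apply/andP; split; lra.
  by rewrite /r; lra.
have bottom q (x : R) : 0 <= x <= 1 -> q = p \/ q = z0 -> N (q + (x * r)%:C - z0) < rho.
  move=> /andP[x0 x1] qE; apply: sq_near.
  have /andP[xr0 xr1] : 0 <= x * r <= r by rewrite mulr_ge0 ?(ltW r0)//= ler_piMl// ltW.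
  by case: qE => ->; rewrite /in_square /p; case: (z0) => a b /=; split; apply/andP; split; lra.
have side q (v : R[i]) :
    (forall t : R, 0 <= t <= 1 -> in_square p s (q + t%:C * v) /\ q + t%:C * v != z0) ->
    exists2 c : R, 0 < c & forall t : R, 0 <= t <= 1 -> c <= re (u (q + t%:C * v)).
  by move=> H; apply: segment_re_ge => t /H[/sq_near/Hu[du up] /up].
have ts t : 0 <= t <= 1 -> 0 <= t * s <= s.
  by move=> /andP[t0 t1]; rewrite mulr_ge0 ?(ltW s0)//= ler_piMl// ltW.
have [c1 c1_gt0 Hc1] : exists2 c : R, 0 < c & forall t : R, 0 <= t <= 1 ->
    c <= re (u (p + s%:C + t%:C * ('i * s%:C))).
  apply: side => t /ts /andP[t0 t1]; split.
    by rewrite /in_square /p; case: (z0) => a b /=; simpc => /=; split; apply/andP; split; lra.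
  apply/eqP => /(congr1 re); rewrite /p; case: (z0) => a b /=; simpc => /=; lra.
have [c2 c2_gt0 Hc2] : exists2 c : R, 0 < c & forall t : R, 0 <= t <= 1 ->
    c <= re (u (p + 'i * s%:C + t%:C * s%:C)).
  apply: side => t /ts /andP[t0 t1]; split.
    by rewrite /in_square /p; case: (z0) => a b /=; simpc => /=; split; apply/andP; split; lra.
  apply/eqP => /(congr1 im); rewrite /p; case: (z0) => a b /=; simpc => /=; lra.
have [c3 c3_gt0 Hc3] : exists2 c : R, 0 < c & forall t : R, 0 <= t <= 1 ->
    c <= re (u (p + t%:C * ('i * s%:C))).
  apply: side => t /ts /andP[t0 t1]; split.
    by rewrite /in_square /p; case: (z0) => a b /=; simpc => /=; split; apply/andP; split; lra.
  apply/eqP => /(congr1 re); rewrite /p; case: (z0) => a b /=; simpc => /=; lra.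
pose c := Num.min c1 (Num.min c2 c3).
have c0 : 0 < c by rewrite !lt_min c1_gt0 c2_gt0.
(* [A] bounds each of the three other sides whatever [t] is; [e] is chosen so that
   [(4 * e)^-1 = 3 * A + 2]. *)
pose A := s / c; have A0 : 0 < A by rewrite divr_gt0.
pose e := (4 * (3 * A + 2))^-1.
have e0 : 0 < e by rewrite invr_gt0; lra.
have [d d0 Hd] := flat e e0.
have half01 : 0 < (2^-1 : R) < 1 by apply/andP; split; lra.
have [m /(_ m (leqnn m)) Hm] := expr_lt_eps r half01 d0.
(* On the dyadic piece from [z0] to [z0 + v], flatness gives [N (u w) <= e * v = t]. There
   [re (k w)] is at least [t / (2 * t) ^+ 2], so the piece contributes at least
   [v / (4 * t) = (4 * e)^-1]. *)
pose v := r / 2 ^+ m; have vE : v = r * 2^-1 ^+ m by rewrite exprVn.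
have v0 : 0 < v by rewrite divr_gt0 ?exprn_gt0.
pose t := e * v; have t0 : 0 < t by rewrite mulr_gt0.
pose k (z : R[i]^o) : R[i]^o := (t%:C + u z)^-1.
have re_tu z : re (t%:C + u z) = t + re (u z) by rewrite ReD.
have re_k z : 0 <= re (u z) -> re (k z) = (t + re (u z)) / N (t%:C + u z) ^+ 2.
  move=> uz; rewrite normc_sqr -re_tu /k; by case: (t%:C + u z) => a b.
have k_ge0 z : 0 <= re (u z) -> 0 <= re (k z).
  by move=> uz; rewrite re_k// divr_ge0 ?exprn_ge0 ?normc_ge0//; lra.
have k_le z (b : R) : 0 < b -> b <= re (u z) -> N (k z) <= b^-1.
  move=> b0 bu; rewrite Normc.normcV lef_pV2 ?posrE//; last first.
    by apply: lt_le_trans (re_le_normc _); rewrite re_tu; lra.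
  by apply: le_trans (re_le_normc _); rewrite re_tu; lra.
have [n0 Hn0] : exists n0, forall n, (n0 <= n)%N ->
    N (square_sum k n p s%:C) <= s ^- 2 * s ^+ 2.
  apply: goursat => //; first by rewrite invr_gt0 exprn_gt0.
  move=> z /sq_near zr; have uz := re_ge0 _ zr.
  apply: (derivable_invc (f := fun z => t%:C + u z)).
    apply/eqP => E; have := re_tu z; rewrite E /=; lra.
  by apply: (derivable_addc (f := fun=> t%:C)); [exact: derivable_constc|exact: (Hu _ zr).1].
(* One halving makes [z0] a subdivision point, [m] more isolate the piece of length [v], and [n0]
   suffice for Goursat. The total is then at most 1 in modulus, against a real part of at least
   [3 * A + 2 - 3 * A]. *)
have := Hn0 (m + n0).+1 (leqW (leq_addl _ _)).
rewrite mulVf ?expf_neq0 ?gt_eqF//.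
have Ns : N (s%:C : R[i]) = s by rewrite normcR ger0_norm// ltW.
have Nis : N ('i * s%:C : R[i]) = s.
  by rewrite Normc.normcM Ns /= expr0n expr1n add0r sqrtr1 mul1r.
have H1 : N (riemann_sum k (m + n0).+1 (p + s%:C) ('i * s%:C)) <= A.
  rewrite /A -[X in X / c]Nis; apply: riemann_sum_le => x x01; apply: k_le => //.
  by apply: le_trans (Hc1 x x01); rewrite ge_min lexx.
have H2 : N (riemann_sum k (m + n0).+1 (p + 'i * s%:C) s%:C) <= A.
  rewrite /A -[X in X / c]Ns; apply: riemann_sum_le => x x01; apply: k_le => //.
  by apply: le_trans (Hc2 x x01); rewrite !ge_min lexx orbT.
have H3 : N (riemann_sum k (m + n0).+1 p ('i * s%:C)) <= A.
  rewrite /A -[X in X / c]Nis; apply: riemann_sum_le => x x01; apply: k_le => //.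
  by apply: le_trans (Hc3 x x01); rewrite !ge_min lexx !orbT.
have H4 : 3 * A + 2 <= re (riemann_sum k (m + n0).+1 p s%:C).
  have s2 : s%:C / 2 = r%:C :> R[i] by rewrite sE rmorphM/= rmorph_nat mulrAC divff ?mul1r.
  rewrite /= s2 ReD; have -> : p + r%:C = z0 by rewrite /p subrK.
  have near0 q x : 0 <= x <= 1 -> q = p \/ q = z0 -> 0 <= re (k (q + (x * r)%:C)).
    by move=> x01 qE; apply: k_ge0; apply: re_ge0; exact: bottom.
  have left0 : 0 <= re (riemann_sum k (m + n0) p r%:C).
    rewrite -(mulr0 r); apply: re_riemann_sum_ge; first exact: ltW.
    by move=> x x01; apply: near0 => //; left.
  have right_sub : re (riemann_sum k n0 z0 v%:C) <= re (riemann_sum k (m + n0) z0 r%:C).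
    apply: re_riemann_sum_sub; first exact: ltW.
    by move=> x x01; apply: near0 => //; right.
  have : v * (4 * t)^-1 <= re (riemann_sum k n0 z0 v%:C).
    apply: re_riemann_sum_ge; first exact: ltW.
    move=> x /andP[x0 x1].
    have xv : 0 <= x * v <= v by rewrite mulr_ge0 ?(ltW v0)//= ler_piMl// ltW.
    have /andP[xv0 xv1] := xv.
    have xr : N (z0 + (x * v)%:C - z0) = x * v by rewrite addrC addKr normcR ger0_norm.
    have ux : N (u (z0 + (x * v)%:C)) <= t.
      apply: le_trans (Hd _ _) _; rewrite xr; last by rewrite ler_wpM2l// ltW.
      by apply: le_lt_trans xv1 _; rewrite vE.
    have vr : v <= r by rewrite vE ler_piMr ?(ltW r0)// exprn_ile1 ?invr_ge0 ?invf_le1// ler1n.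
    have ux0 : 0 <= re (u (z0 + (x * v)%:C)).
      by apply: re_ge0; rewrite xr; move: vr; rewrite /r; lra.
    have tu : N (t%:C + u (z0 + (x * v)%:C)) <= 2 * t.
      by apply: le_trans (normcD _ _) _; rewrite normcR ger0_norm ?(ltW t0)//; lra.
    have tu0 : 0 < N (t%:C + u (z0 + (x * v)%:C)).
      by apply: lt_le_trans (re_le_normc _); rewrite re_tu; lra.
    rewrite re_k// ler_pdivlMr ?exprn_gt0//.
    apply: (@le_trans _ _ ((4 * t)^-1 * (2 * t) ^+ 2)).
      apply: ler_wpM2l; first by rewrite invr_ge0 mulr_ge0 ?(ltW t0).
      by apply: lerXn2r => //; rewrite nnegrE ltW// mulr_gt0.
    have -> : (4 * t)^-1 * (2 * t) ^+ 2 = t by field; rewrite gt_eqF.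
    lra.
  have -> : v * (4 * t)^-1 = 3 * A + 2.
    rewrite /t [4 * _]mulrA invfM mulrCA mulfV ?gt_eqF// mulr1 /e invfM invrK.
    by rewrite mulKf// pnatr_eq0.
  lra.
move=> H5; have := le_trans (le_trans (ler_norm _) (ler_Re_normc _)) H5.
rewrite /square_sum !ReB ReD.
have := le_trans (ler_Re_normc _) H1; have := le_trans (ler_Re_normc _) H2.
have := le_trans (ler_Re_normc _) H3; rewrite !ler_norml.
by move=> /andP[? ?] /andP[? ?] /andP[? ?]; lra.
Qed.

End PositiveRealPart.

(** The function [1 - f] vanishes at [z], and [re (f w) <= N (f w) < 1] makes its real part positive
    at nearby points. *)
Lemma interior_not_peak (R : realType) (K : set R[i]^o) (z : R[i]^o) :
  interior K z -> ~ peak_point K (algebraA K) z.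
Proof.
move=> Kiz [Kz [f [[_ df] fz1 flt]]].
apply: (@re_gt0_not_zero _ (fun w => 1 - f w) z); first by rewrite fz1 subrr.
have : nbhs z (interior K) by exact: nbhs_interior.
apply: filterS => w Kiw; split.
  by apply: (derivable_subc (f := fun=> 1)); [exact: derivable_constc|exact: df].
move=> wz; have : `|f w| < 1.
  by apply: flt; split; [exact: interior_subset|exact/eqP].
rewrite normr_normc (ltcR _ 1) => f1.
by rewrite ReB subr_gt0 /=; apply: le_lt_trans (re_le_normc _) f1.
Qed.

Theorem theorem7p8 (R : realType) (K : set R[i]^o)
    (compactK : compact K) (connectedCK : connected (~` K)) :
  (forall z0 : R[i]^o, boundary K z0 -> peak_point K (algebraA K) z0) /\
  peak_points K (algebraA K) = boundary K.
Proof.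
have closedK : closed K by apply: compact_closed => //; exact: (@norm_hausdorff _ R[i]^o).
have bd z0 : boundary K z0 -> peak_point K (algebraA K) z0.
  move=> [clz niz]; apply: boundary_peak_point => //; first exact: closedK.
  (* A neighbourhood missing the complement of [K] would make [z0] an interior point. *)
  move=> B nB; apply: contrapT => nex; apply: niz.
  by apply: filterS nB => w Bw; apply: contrapT => nKw; apply: nex; exists w.
split => //; apply/seteqP; split => z; last exact: bd.
move=> pz; split; first by apply: subset_closure; case: pz.
by move=> /interior_not_peak; apply.
Qed.
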